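(* Let $F=(F_i)_{i\in\mathbb{Z}}$ be an independent environment and let $d$ be the semidiscrete (line last passage) metric of negative sign of $F$ on $\mathbb{R}\times\mathbb{Z}$. Let $A,B\subset\mathbb{R}\times\mathbb{Z}$ be finite unions of bounded product sets. For $p,q\in\mathbb{R}\times\mathbb{Z}$, $c\in\mathbb{R}$ and $\epsilon>0$ we have $$\mathbb{P}\big(d(p,q)\le c-2\epsilon,\ c<d(A,B)\big)\le\sup_{a\in A}\mathbb{P}\big(d(p,a)<-\epsilon\big)+\sup_{b\in B}\mathbb{P}\big(d(b,q)<-\epsilon\big),$$ where $d(A,B)=\sup\{d(a,b):a\in A,b\in B\}$.
   Context: Bounded product set: a bounded set of the form $S\times T$ with $S\subset\mathbb{R}$ and $T\subset\mathbb{Z}$. Independent environment: a collection of random cadlag functions $F_i:\mathbb{R}\to\mathbb{R}$, $i\in\mathbb{Z}$, with no negative jumps, such that for any disjoint sets $[a_1,b_1]\times\{j_1\},\dots,[a_k,b_k]\times\{j_k\}\subset\mathbb{R}\times\mathbb{Z}$ the increments $F_{j_i}(b_i)-F_{j_i}(a_i)$, $i=1,\dots,k$, are independent. Semidiscrete metric: for $(x,n),(y,m)\in\mathbb{R}\times\mathbb{Z}$ with $x\le y$ and $n\ge m$, $$d((x,n),(y,m))=-(F_n(x)-F_n(x^-))+\sup\sum_{i=m}^n\big(F_i(t_{i-1})-F_i(t_i^-)\big),$$ where $F_i(t^-)$ denotes the left limit of $F_i$ at $t$ and the supremum is over $x=t_n\le t_{n-1}\le\dots\le t_m\le t_{m-1}=y$.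 If $x>y$ or $n<m$, then $d((x,n),(y,m))=-\infty$. This $d$ is a directed metric of negative sign: $d(p,p)=0$ and $d(p,r)\ge d(p,q)+d(q,r)$ for all $p,q,r$. *)

(* Defs.v *)
From HB Require Import structures.
From mathcomp Require Import all_boot all_order all_algebra.
From mathcomp Require Import all_classical all_reals all_analysis.

Set Implicit Arguments.
Unset Strict Implicit.
Unset Printing Implicit Defensive.

Import Order.TTheory GRing.Theory Num.Theory.
Import numFieldNormedType.Exports.

Local Open Scope classical_set_scope.
Local Open Scope ring_scope.

Definition left_limit (R : realType) (f : R -> R) (t : R) : R :=
  lim (f @ t^'-).

Definition cadlag (R : realType) (f : R -> R) : Prop :=
  right_continuous f /\ forall t : R, cvg (f @ t^'-).

Definition no_negative_jump (R : realType) (f : R -> R) : Prop :=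
  forall t : R, left_limit f t <= f t.

(* Subfamilies are covered by taking some of the [B i] equal to [setT]. *)
Definition mutually_independent (d : measure_display) (T : measurableType d)
    (R : realType) (P : probability T R) (k : nat) (X : 'I_k -> T -> R) : Prop :=
  forall B : 'I_k -> set R, (forall i, measurable (B i)) ->
    P (\bigcap_(i in [set: 'I_k]) (X i @^-1` B i)) =
    (\prod_(i < k) P (X i @^-1` B i))%E.

(* The sets [[a i, b i] x {j i}] are genuine intervals: without [a i <= b i]
   they could be empty, hence vacuously disjoint from anything. *)
Definition independent_increments (d : measure_display) (T : measurableType d)
    (R : realType) (P : probability T R) (F : int -> R -> {RV P >-> R}) : Prop :=
  forall (k : nat) (a b : 'I_k -> R) (j : 'I_k -> int),
    (forall i, a i <= b i) ->
    trivIset [set: 'I_k] (fun i => `[a i, b i] `*` [set j i]) ->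
    mutually_independent P
      (fun (i : 'I_k) (w : T) => F (j i) (b i) w - F (j i) (a i) w).

Definition independent_environment (d : measure_display)
    (T : measurableType d) (R : realType) (P : probability T R)
    (F : int -> R -> {RV P >-> R}) : Prop :=
  [/\ forall (w : T) (i : int), cadlag (fun t => F i t w),
      forall (w : T) (i : int), no_negative_jump (fun t => F i t w) &
      independent_increments F].

(* Sequences x = t_n <= t_(n-1) <= ... <= t_m <= t_(m-1) = y; the values of
   [t] outside [m-1, n] are irrelevant. *)
Definition jump_times (R : realType) (x : R) (n : int) (y : R) (m : int) :
    set (int -> R) :=
  [set t | [/\ t n = x, t (m - 1) = y &
               forall i : int, m <= i <= n -> t i <= t (i - 1)]].

(* The sum over the integers i = m, ..., n, written with i = m + k. *)
Definition path_weight (R : realType) (f : int -> R -> R) (n m : int)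
    (t : int -> R) : R :=
  \sum_(0 <= k < `|n - m|%N.+1)
    (f (m + k%:Z) (t (m + k%:Z - 1))
     - left_limit (f (m + k%:Z)) (t (m + k%:Z))).

Definition semidiscrete_metric (R : realType) (f : int -> R -> R)
    (p q : R * int) : \bar R :=
  let: (x, n) := p in
  let: (y, m) := q in
  if (x <= y) && (m <= n) then
    ((- (f n x - left_limit (f n) x))%:E
     + ereal_sup [set (path_weight f n m t)%:E | t in jump_times x n y m])%E
  else -oo%E.

Definition set_to_set (R : realType) (X : Type) (d : X -> X -> \bar R)
    (A B : set X) : \bar R :=
  ereal_sup [set d ab.1 ab.2 | ab in A `*` B].

Definition bounded_product_set (R : realType) (C : set (R * int)) : Prop :=
  (exists (S : set R) (U : set int), C = S `*` U) /\
  (exists M : R, forall p, C p -> `|p.1| <= M /\ `|p.2|%:~R <= M).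

Definition finite_union_of_bounded_product_sets (R : realType)
    (A : set (R * int)) : Prop :=
  exists (k : nat) (C : 'I_k -> set (R * int)),
    (forall i, bounded_product_set (C i)) /\
    A = \bigcup_(i in [set: 'I_k]) C i.

Definition random_metric (d : measure_display) (T : measurableType d)
    (R : realType) (P : probability T R) (F : int -> R -> {RV P >-> R}) (w : T) :
    R * int -> R * int -> \bar R :=
  semidiscrete_metric (fun i t => F i t w).

(* The real supremum satisfies [sup set0 = 0], the right value for the empty
   family in [0, 1]; [fine] turns the extended real [P _] into a real. *)
Definition sup_prob (d : measure_display) (T : measurableType d)
    (R : realType) (P : probability T R) (X : Type) (A : set X)
    (E : X -> set T) : R :=
  sup [set fine (P (E a)) | a in A].

(* Main.v *)
(* Call past of a point a = (s, k) the lines above k together with line k up to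
   time s, and future the lines below k together with line k from time s on. The
   increments in the past and in the future of a are independent; d(p, a) depends
   only on the past of a, d(a, b) only on its future.

   Reduce to finite A and B, and let a be the first point of A, searched from the
   lowest line up and from right to left, with d(a, B) > c. The choice of a
   depends only on the future of a, so d(p, a) < - eps has conditional
   probability at most the first supremum. Otherwise d(p, b) > c - eps for some b
   in B; let b be the first such point in the opposite order. This choice depends
   only on the past of b, so d(b, q) < - eps has conditional probability at most
   the second supremum. If neither exception occurs, then d(p, q) > c - 2 eps.

   The absence of negative jumps enters twice: it makes d lower semicontinuous in
   its starting point from the left, hence allows countable A and B, and it makes
   d a limit of its discretizations, hence measurable. *)
Require Import Defs.
From HB Require Import structures.
From mathcomp Require Import all_boot all_order all_algebra.
From mathcomp Require Import all_classical all_reals all_analysis.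
From mathcomp Require Import measurable_realfun.
From mathcomp Require Import zify ring lra.

Set Implicit Arguments.
Unset Strict Implicit.
Unset Printing Implicit Defensive.

Import Order.TTheory GRing.Theory Num.Theory.
Import numFieldNormedType.Exports.

Local Open Scope classical_set_scope.
Local Open Scope ring_scope.

(** * Paths and the reverse triangle inequality *)

(* With [h k] the line [m + k] and [tau k] the time at which the path leaves it,
   this is the weight of the path minus the jump of the first line at [x]. *)
Definition path_value (R : realType) (h : nat -> R -> R) (N : nat) (x : R)
    (tau : nat -> R) : R :=
  \sum_(0 <= k < N) (h k (tau k) - left_limit (h k) (tau k.+1))
  + (h N (tau N) - h N x).

Definition path_times (R : realType) (N : nat) (x y : R) : set (nat -> R) :=
  [set tau | [/\ tau 0%N = y, forall k, (k < N)%N -> tau k.+1 <= tau k &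
                 x <= tau N]].

Lemma path_times_le (R : realType) (N : nat) (x y : R) (tau : nat -> R) :
  path_times N x y tau ->
  forall k, (k <= N)%N -> x <= tau k <= y.
Proof.
case=> t0 tle txN.
have mono i j : (i <= j)%N -> (j <= N)%N -> tau j <= tau i.
  elim: j => [|j IH]; first by rewrite leqn0 => /eqP ->.
  rewrite leq_eqVlt => /orP[/eqP -> //|ij jN].
  by apply: le_trans (tle _ jN) _; apply: IH; [exact: ij|exact: ltnW].
move=> k kN; apply/andP; split; first by apply: le_trans txN _; exact: mono.
by rewrite -t0; exact: mono.
Qed.

(** The jump term in front of the supremum cancels the left limit at [x] in the summand of the top
    line, which leaves [path_value]. A strict lower bound by a real number is witnessed by a single
    path; such bounds serve in place of the extended real value from here on. *)
Lemma metric_gtP (R : realType) (f : int -> R -> R) (x y : R) (n m : int)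
    (c : R) :
  (c%:E < semidiscrete_metric f (x, n) (y, m))%E <->
  [/\ x <= y, m <= n &
    exists2 tau, path_times `|n - m| x y tau &
      c < path_value (fun k => f (m + k%:Z)) `|n - m| x tau].
Proof.
rewrite /semidiscrete_metric.
case: ifPn => [/andP[xy mn]|/negP nxy]; last first.
  by split=> // -[xy mn _]; case: nxy; rewrite xy mn.
set N := `|n - m|%N; set j := f n x - _.
have nE : n = m + N%:Z by rewrite /N; lia.
have keyE tau t : (forall k, (k <= N)%N -> t (m + k%:Z - 1) = tau k) ->
    t n = x -> path_weight f n m t - j =
    path_value (fun k => f (m + k%:Z)) N x tau.
  clearbody N; clear xy.
  move=> tt tx; rewrite /path_weight (_ : `|n - m|%N = N); last by lia.
  have tE k : (k < N)%N -> t (m + k%:Z) = tau k.+1.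
    by move=> kN; rewrite -(tt _ kN); congr t; lia.
  have e : \sum_(0 <= k < N) (f (m + k%:Z) (t (m + k%:Z - 1))
      - left_limit (f (m + k%:Z)) (t (m + k%:Z))) =
    \sum_(0 <= k < N) (f (m + k%:Z) (tau k)
      - left_limit (f (m + k%:Z)) (tau k.+1)).
    by apply: eq_big_nat => k /andP[_ kN]; rewrite (tE _ kN) (tt _ (ltnW kN)).
  rewrite big_nat_recr//= e (tt _ (leqnn N)) -nE tx /path_value -nE /j.
  ring.
rewrite addeC -lteBlDr//= -EFinB opprK.
split=> [|[_ _ [tau [t0 tle txN] ctau]]].
  case/ereal_sup_gt => _ [t [tn tm tle] <-]; rewrite lte_fin => ct.
  split=> //; exists (fun k : nat => t (m + k%:Z - 1)).
    split; first by rewrite addr0.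
    - move=> k kN.
      have -> : m + k.+1%:Z - 1 = m + k%:Z by lia.
      by apply: tle; lia.
    - rewrite -tn.
      have -> : m + N%:Z - 1 = n - 1 by lia.
      by apply: tle; lia.
  by rewrite -(keyE _ t)//; lra.
(* [tau] is unconstrained beyond [N], so the value [x] at line [n] has to be prescribed
   separately. *)
pose t (i : int) := if i == n then x else tau (absz (i - (m - 1))%R).
have tE k : (k <= N)%N -> t (m + k%:Z - 1) = tau k.
  move=> kN; rewrite /t ifF; last by apply/eqP; lia.
  by congr tau; lia.
have tn : t n = x by rewrite /t eqxx.
apply: (@lt_le_trans _ _ (path_weight f n m t)%:E).
  by rewrite lte_fin; move: ctau; rewrite -(keyE _ t)//; lra.
apply: ereal_sup_ubound; exists t => //; split=> //.
  by have := tE 0%N isT; rewrite addr0 => ->.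
move=> i /andP[mi ini].
have [k ik kN] : exists2 k : nat, i = m + k%:Z & (k <= N)%N.
  by exists `|i - m|%N; lia.
move: kN; rewrite leq_eqVlt => /orP[/eqP kN|kN].
  have -> : i = n by rewrite ik kN nE.
  by rewrite tn nE tE.
by rewrite ik tE ?(ltnW kN)// (_ : m + k%:Z = m + k.+1%:Z - 1) ?tE//; [exact: tle|lia].
Qed.

(** Lines are counted upwards from the end point, so the later piece [sigma] comes first. Both
    pieces use line [M], where [- h M s] cancels [h M (tau 0)]; the values add up exactly because
    [path_value] subtracts the value, not the left limit, at its starting time. *)
Lemma path_value_cat (R : realType) (h : nat -> R -> R) (M N : nat)
    (x s y : R) (sigma tau : nat -> R) :
  path_times M s y sigma -> path_times N x s tau ->
  let rho := fun i => if (i <= M)%N then sigma i else tau (i - M)%N in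
  path_times (M + N) x y rho /\
  path_value h (M + N) x rho =
  path_value h M s sigma + path_value (fun k => h (M + k)%N) N x tau.
Proof.
move=> /[dup] ss [s0 sle ssM] /[dup] tt [t0 tle txN] rho.
have sE i : (i <= M)%N -> rho i = sigma i by rewrite /rho => ->.
have tE i : (0 < i)%N -> rho (M + i)%N = tau i.
  by move=> i0; rewrite /rho ifF; [congr tau; lia|lia].
split.
  split=> [|k kMN|]; first by rewrite sE.
  - have [kM|Mk] := ltnP k M; first by rewrite !sE// ?(ltnW kM)//; exact: sle.
    have [j -> {kMN Mk}jN] : exists2 j, k = (M + j)%N & (j < N)%N.
      by exists (k - M)%N; lia.
    rewrite -addnS tE//; case: j jN => [|j] jN.
      by rewrite addn0 sE//; apply: le_trans ssM; rewrite -t0; exact: tle.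
    by rewrite tE//; exact: tle.
  - case: N tE tt tle txN => [|N] tE tt tle txN.
      by rewrite addn0 sE//; apply: le_trans ssM; rewrite -t0.
    by rewrite tE.
have splitE (E : nat -> R) : \sum_(0 <= k < M + N) E k =
    \sum_(0 <= k < M) E k + \sum_(0 <= k < N) E (M + k)%N.
  rewrite (big_cat_nat (leq0n M) (leq_addr N M))/=; congr +%R.
  by rewrite -{1}[M]add0n big_addn addKn; apply: eq_big_nat => k _; rewrite addnC.
rewrite /path_value splitE.
have -> : \sum_(0 <= k < M) (h k (rho k) - left_limit (h k) (rho k.+1)) =
    \sum_(0 <= k < M) (h k (sigma k) - left_limit (h k) (sigma k.+1)).
  by apply: eq_big_nat => k /andP[_ kM]; rewrite !sE// ltnW.
clear splitE; case: N tt tle txN tE => [|N] tt tle txN tE.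
  by rewrite !big_nil !addn0 sE// t0; ring.
rewrite tE// !(big_nat_recl N)//= addn0 -addn1 tE// sE// t0.
have -> : \sum_(0 <= i < N) (h (M + i.+1)%N (rho (M + i.+1)%N)
      - left_limit (h (M + i.+1)%N) (rho (M + i.+1).+1)) =
    \sum_(0 <= i < N) (h (M + i.+1)%N (tau i.+1)
      - left_limit (h (M + i.+1)%N) (tau i.+2)).
  by apply: eq_big_nat => i _; rewrite -addnS !tE.
ring.
Qed.

Lemma metric_triangle (R : realType) (f : int -> R -> R) (p r q : R * int)
    (a b : R) :
  (a%:E < semidiscrete_metric f p r)%E -> (b%:E < semidiscrete_metric f r q)%E ->
  ((a + b)%:E < semidiscrete_metric f p q)%E.
Proof.
case: p r q => [x n] [s k] [y m].
move=> /metric_gtP[xs kn [tau taut av]] /metric_gtP[sy mk [sigma sigt bv]].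
apply/metric_gtP; split; [exact: le_trans sy|exact: le_trans kn|].
have [rt rv] := path_value_cat (fun k => f (m + k%:Z)) sigt taut.
have E : (`|k - m| + `|n - k| = `|n - m|)%N by lia.
rewrite E in rt rv; eexists; first exact: rt.
rewrite rv [ltRHS]addrC ltrD//; move: av.
have <- : (fun i => f (m + (`|k - m| + i)%N%:Z)) = (fun i => f (k + i%:Z)).
  by apply/funext => i; congr f; lia.
by [].
Qed.

(** * Discretization of the metric *)

Lemma ultra_image_map (T U : Type) (f : T -> U) (F : set_system T) :
  UltraFilter F -> UltraFilter (f @ F).
Proof.
move=> FU; split; first exact: fmap_proper_filter.
move=> G GP FG; apply/seteqP; split=> // A GA.
have [//|FnA] := in_ultra_setVsetC (f @^-1` A) FU.
have GnA : G (~` A) by exact: FG.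
by have [? []] := filter_ex (filterI GA GnA).
Qed.

Lemma cadlag_right (R : realType) (f : R -> R) (t eta : R) :
  cadlag f -> 0 < eta ->
  exists2 delta, 0 < delta &
    forall z, t <= z -> z < t + delta -> `|f z - f t| < eta.
Proof.
move=> [rc _] eta0; have /cvgrPdist_lt/(_ _ eta0) := rc t.
move=> /nbhs_ballP[delta /= delta0 fd]; exists delta => // z.
rewrite le_eqVlt => /orP[/eqP <- _|tz ztd]; first by rewrite subrr normr0.
rewrite distrC; apply: (fd z) => //.
by rewrite /ball/= ltr_distlC; apply/andP; split; lra.
Qed.

Lemma cadlag_left (R : realType) (f : R -> R) (t eta : R) :
  cadlag f -> 0 < eta ->
  exists2 delta, 0 < delta &
    forall z, t - delta < z -> z < t -> `|f z - left_limit f t| < eta.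
Proof.
move=> [_ /(_ t) ll] eta0; have /cvgrPdist_lt/(_ _ eta0) := ll.
move=> /nbhs_ballP[delta /= delta0 fd]; exists delta => // z tz zt.
rewrite distrC; apply: (fd z) => //.
by rewrite /ball/= ltr_distlC; apply/andP; split; lra.
Qed.

(* The absence of negative jumps makes the process upper semicontinuous, and
   its left limits a lower bound for the values nearby. *)
Lemma cadlag_near (R : realType) (f : R -> R) (t eta : R) :
  cadlag f -> no_negative_jump f -> 0 < eta ->
  \forall z \near t, left_limit f t - eta < f z < f t + eta.
Proof.
move=> cf jf eta0.
have [d1 d10 fd1] := cadlag_right t cf eta0.
have [d2 d20 fd2] := cadlag_left t cf eta0.
have jt := jf t.
apply/nbhs_ballP; exists (Num.min d1 d2) => /=; first by rewrite lt_min d10.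
move=> z; rewrite /ball/= ltr_distlC => /andP[].
rewrite ltrBlDr -ltrBlDl lt_min => /andP[zd1 zd2].
have [tz|zt] := lerP t z => ztd.
  have ztd1 : z < t + d1 by apply: lt_le_trans ztd _; rewrite lerD2l ge_min lexx.
  by have := fd1 _ tz ztd1; rewrite ltr_distl => /andP[h1 h2]; apply/andP; split; lra.
have zl : t - d2 < z by lra.
have := fd2 _ zl zt; rewrite ltr_distl.
by move=> /andP[h1 h2]; apply/andP; split; lra.
Qed.

Section approximate_paths.
Context (R : realType) (h : nat -> R -> R) (N : nat) (x y : R).
Hypothesis hc : forall k, cadlag (h k).

(* The entry [k] of [s] is a short window [(u, v)] around the time at which the
   path jumps from line [k + 1] to line [k]: line [k + 1] is left at [v] and
   line [k] is entered at [u]. *)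
Definition approx_left (s : seq (rat * rat)) (k : nat) : R :=
  ratr (nth (0, 0) s k).1.

Definition approx_right (s : seq (rat * rat)) (k : nat) : R :=
  if k is j.+1 then Num.min (ratr (nth (0, 0) s j).2) y else y.

(** No value of [h] occurs, so for random lines this condition is deterministic. The order of the
    windows holds only up to [delta], and [approx_left] may fall before [x]. *)
Definition approx_times (delta : R) (s : seq (rat * rat)) : Prop :=
  forall k, (k < N)%N ->
    [/\ x <= approx_right s k.+1, approx_right s k.+1 <= approx_right s k + delta,
        approx_right s k.+1 - delta <= approx_left s k &
        approx_left s k < approx_right s k.+1].

Definition approx_value (s : seq (rat * rat)) : R :=
  \sum_(0 <= k < N) (h k (approx_right s k) - h k (approx_left s k))
  + (h N (approx_right s N) - h N x).

Lemma approx_right_le s k : approx_right s k <= y.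
Proof. by case: k => [|k] //=; rewrite ge_min lexx orbT. Qed.

(** Rational times near the jump times suffice: right continuity of the upper line provides the
    right end of each window, the left limit of the lower line its left end. *)
Lemma approx_path (tau : nat -> R) (delta c : R) :
  0 < delta -> path_times N x y tau -> c < path_value h N x tau ->
  exists2 s, approx_times delta s & c < approx_value s.
Proof.
move=> delta0 taut ctau.
(* Each of the [N] lower lines costs at most [2 * eta] and the top line at most [eta], in total less
   than the excess over [c]. *)
pose eta := (path_value h N x tau - c) / (2 * (N%:R + 1)).
have N0 : 0 < N%:R + 1 :> R by rewrite ltr_wpDl.
have eta0 : 0 < eta by rewrite divr_gt0 ?subr_gt0// mulr_gt0.
have /choice[q qP] : forall k, exists q : rat * rat, (k < N)%N ->
    let v := Num.min (ratr q.2) y in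
    [/\ tau k.+1 <= v, v <= tau k.+1 + delta / 2,
        tau k.+1 - delta / 2 < ratr q.1 < tau k.+1,
        h k.+1 (tau k.+1) - eta < h k.+1 v &
        h k (ratr q.1) < left_limit (h k) (tau k.+1) + eta].
  move=> k; have [kN|] := ltnP k N; last by exists (0, 0).
  have /andP[_ ty] := path_times_le taut kN.
  set t := tau k.+1 in ty *.
  have [d1 d10 fd1] := cadlag_right t (hc k.+1) eta0.
  have [d2 d20 fd2] := cadlag_left t (hc k) eta0.
  (* Half of [delta] on either side of [t] makes the window shorter than [delta]. *)
  have m1 : t < t + Num.min d1 (delta / 2).
    by rewrite ltrDl lt_min d10 divr_gt0.
  have m2 : t - Num.min d2 (delta / 2) < t.
    by rewrite gtrBl lt_min d20 divr_gt0.
  have [q2] := rat_in_itvoo m1; rewrite in_itv/= => /andP[tq2].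
  rewrite -ltrBlDl lt_min => /andP[q2d1 q2delta].
  have [q1] := rat_in_itvoo m2; rewrite in_itv/= => /andP[+ tq1].
  rewrite ltrBlDr -ltrBlDl lt_min => /andP[q1d2 q1delta].
  exists (q1, q2) => _ /=.
  have tv : t <= Num.min (ratr q2) y by rewrite le_min ty (ltW tq2).
  have vq : Num.min (ratr q2) y <= ratr q2 by rewrite ge_min lexx.
  split=> //.
  - by apply: le_trans vq _; lra.
  - by apply/andP; split; [lra|].
  - have vd1 : Num.min (ratr q2) y < t + d1 by apply: le_lt_trans vq _; lra.
    by have := fd1 _ tv vd1; rewrite ltr_distl => /andP[].
  - have q1d : t - d2 < ratr q1 by lra.
    by have := fd2 _ q1d tq1; rewrite ltr_distl => /andP[].
have [t0 tle txN] := taut.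
pose s := mkseq q N.
have sE k : (k < N)%N -> nth (0, 0) s k = q k by move=> kN; rewrite nth_mkseq.
have rge k : (k <= N)%N -> tau k <= approx_right s k.
  case: k => [|k] kN; first by rewrite t0.
  by rewrite /= sE//; case: (qP _ kN).
have rh k : (k <= N)%N -> h k (tau k) - eta < h k (approx_right s k).
  case: k => [|k] kN; first by rewrite t0 gtrBl.
  by rewrite /= sE//; case: (qP _ kN).
exists s.
  move=> k kN; have := rge k (ltnW kN); have := rge k.+1 kN.
  have /andP[xt _] := path_times_le taut kN; have := tle _ kN.
  rewrite /approx_left /= sE//; have /= [tv vt /andP[ut1 ut2] _ _] := qP _ kN.
  by move=> *; split; lra.
have dE : path_value h N x tau - c = N%:R * (2 * eta) + 2 * eta.
  by rewrite /eta; field; rewrite gt_eqF.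
have hs : \sum_(0 <= k < N) (h k (tau k) - left_limit (h k) (tau k.+1)) - N%:R * (2 * eta)
    <= \sum_(0 <= k < N) (h k (approx_right s k) - h k (approx_left s k)).
  have -> : N%:R * (2 * eta) = \sum_(0 <= k < N) (2 * eta).
    by rewrite sumr_const_nat subn0 mulr_natl.
  rewrite -sumrB; apply: ler_sum_nat => k /andP[_ kN].
  have := rh k (ltnW kN); have /= [_ _ _ _] := qP _ kN.
  by rewrite /approx_left sE//; lra.
by have := rh N (leqnn N); move: dE hs; rewrite /path_value /approx_value; lra.
Qed.
Hypothesis hj : forall k, no_negative_jump (h k).

(* Compactness: the approximate paths converge along an ultrafilter. *)
Lemma path_approx (c eps : R) :
  x <= y -> 0 < eps ->
  (forall i : nat, exists s, approx_times i.+1%:R^-1 s /\ c < approx_value s) ->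
  exists2 tau, path_times N x y tau & c - eps < path_value h N x tau.
Proof.
move=> xy eps0 /choice[s sP].
have st i := (sP i).1; have sv i := (sP i).2.
(* What holds eventually holds along [U], and every sequence of times in the compact interval
   [[x, y]] converges along it. *)
have [U [UU oU]] := ultraFilterLemma (@eventually_filter : ProperFilter \oo).
pose r (k i : nat) := approx_right (s i) k.
pose l (k i : nat) := approx_left (s i) k.
have rxy k i : (k <= N)%N -> x <= r k i <= y.
  rewrite /r approx_right_le andbT; case: k => [|k] kN //.
  by case: (st i _ kN).
have /choice[tau tauP] : forall k, exists t : R,
    (k <= N)%N -> [/\ x <= t, t <= y & r k @ U --> t].
  move=> k; have [kN|] := leqP k N; last by exists 0.
  have : compact `[x, y] by exact: segment_compact.
  rewrite compact_ultra => /(_ (r k @ U) (ultra_image_map _ UU))[].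
    by apply: (@filterE _ U) => i /=; rewrite in_itv/= rxy.
  by move=> t [/= txy rt]; exists t => _; move: txy; rewrite in_itv/= => /andP[].
have small d : 0 < d -> \forall i \near U, i.+1%:R^-1 < d :> R.
  by move=> d0; apply: oU; exact: (near_infty_natSinv_lt (PosNum d0)).
have rtau k : (k <= N)%N -> r k @ U --> tau k by move=> /tauP[].
have near_r k d : (k <= N)%N -> 0 < d -> \forall i \near U, `|tau k - r k i| < d.
  by move=> kN d0; have /cvgrPdist_lt/(_ _ d0) := rtau _ kN.
have tau0 : tau 0%N = y.
  by apply: (@norm_cvg_unique _ R^o (r 0%N @ U)); [exact: rtau|exact: cvg_cst].
exists tau.
  split=> // [k kN|]; last by case: (tauP N (leqnn N)).
  (* The order up to [1 / (i + 1)] becomes exact in the limit. *)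
  suff le_eps (e : R) : 0 < e -> tau k.+1 <= tau k + e by exact/ler_addgt0Pr.
  move=> e0; have e30 : 0 < e / 3 by rewrite divr_gt0.
  have [i [[h1 h2] h3]] := @filter_ex _ U _ _ (filterI (filterI
    (near_r _ _ (ltnW kN) e30) (near_r _ _ kN e30)) (small _ e30)).
  move: h1 h2; rewrite !ltr_distl => /andP[h1 h2] /andP[h4 h5].
  have h6 : r k.+1 i <= r k i + i.+1%:R^-1 by case: (st i _ kN).
  have h7 : r k.+1 i < r k i + e / 3 by apply: le_lt_trans h6 _; rewrite ltrD2l; exact: h3.
  by lra.
pose eta := eps / (2 * (N%:R + 1)).
have N0 : 0 < N%:R + 1 :> R by rewrite ltr_wpDl.
have eta0 : 0 < eta by rewrite divr_gt0// mulr_gt0.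
(* The approximate times may converge from either side. [cadlag_near] bounds exit values from above
   by the value at the limit and, in [nl], entry values from below by the left limit: the two
   directions needed. *)
have nr (k : 'I_N.+1) : \forall i \near U, h k (r k i) < h k (tau k) + eta.
  have H : \forall i \near U, left_limit (h k) (tau k) - eta < h k (r k i) <
      h k (tau k) + eta.
    exact: rtau k (ltn_ord k) _ (cadlag_near (tau k) (hc k) (hj k) eta0).
  by apply: filterS H => i /andP[].
have nl (k : 'I_N) :
    \forall i \near U, left_limit (h k) (tau k.+1) - eta < h k (l k i).
  have lt : l k @ U --> tau k.+1.
    apply/cvgrPdist_lt => e e0; have e20 : 0 < e / 2 by rewrite divr_gt0.
    apply: filterS (filterI (near_r _ _ (ltn_ord k) e20) (small _ e20)) => i.
    move=> [h1 h2]; move: h1; rewrite !ltr_distl => /andP[h1 h3].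
    have [_ _] := st i _ (ltn_ord k); rewrite -/(r k.+1 i) -/(l k i) => h4 h5.
    have h6 : r k.+1 i - e / 2 < l k i.
      by apply: lt_le_trans h4; rewrite ltrD2l ltrN2; exact: h2.
    by apply/andP; split; lra.
  have H : \forall i \near U, left_limit (h k) (tau k.+1) - eta < h k (l k i) <
      h k (tau k.+1) + eta.
    exact: lt _ (cadlag_near (tau k.+1) (hc k) (hj k) eta0).
  by apply: filterS H => i /andP[].
have [i [ir il]] := @filter_ex _ U _ _ (filterI
  (filter_forall _ nr) (filter_forall _ nl)).
have epsE : eps = N%:R * (2 * eta) + 2 * eta.
  by rewrite /eta; field; rewrite gt_eqF.
have hs : \sum_(0 <= k < N) (h k (r k i) - h k (l k i)) - N%:R * (2 * eta)
    <= \sum_(0 <= k < N) (h k (tau k) - left_limit (h k) (tau k.+1)).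
  have -> : N%:R * (2 * eta) = \sum_(0 <= k < N) (2 * eta).
    by rewrite sumr_const_nat subn0 mulr_natl.
  rewrite -sumrB; apply: ler_sum_nat => k /andP[_ kN].
  have := ir (Ordinal (ltnW kN : k < N.+1)%N); have := il (Ordinal kN).
  by move=> /=; lra.
have := ir ord_max; have := sv i; move: epsE hs.
by rewrite /path_value /approx_value /r /l/=; lra.
Qed.
End approximate_paths.

Section metric_pathwise.
Context (R : realType) (f : int -> R -> R).
Hypothesis fc : forall i, cadlag (f i).
Hypothesis fj : forall i, no_negative_jump (f i).

Lemma lt_add_invS (c a : R) : c < a -> exists l : nat, c + l.+1%:R^-1 < a.
Proof.
rewrite -subr_gt0 => ca.
have [l _ /(_ _ (leqnn l))/= lP] := near_infty_natSinv_lt (PosNum ca).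
by exists l; rewrite -ltrBrDl.
Qed.

(** The slack [1 / (l + 1)] does not depend on [i], so a strict inequality survives the compactness
    limit. The quantifiers over [l], [i] and [s] range over countable sets, which gives
    measurability later. *)
Lemma metric_gt_approxP (x y : R) (n m : int) (c : R) :
  let N := `|n - m|%N in
  (c%:E < semidiscrete_metric f (x, n) (y, m))%E <->
  [/\ x <= y, m <= n & exists l : nat, forall i : nat, exists s,
    approx_times N x y i.+1%:R^-1 s /\
    c + l.+1%:R^-1 < approx_value (fun k => f (m + k%:Z)) N x y s].
Proof.
move=> N; split.
  move=> /metric_gtP[xy mn [tau taut /lt_add_invS[l ctau]]]; split=> //.
  exists l => i; have i0 : 0 < i.+1%:R^-1 :> R by rewrite invr_gt0.
  have [s st sv] := approx_path (fun k => fc (m + k%:Z)) i0 taut ctau.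
  by exists s.
move=> [xy mn [l H]]; apply/metric_gtP; split=> //.
have l0 : 0 < l.+1%:R^-1 :> R by rewrite invr_gt0.
have [tau taut ctau] := path_approx (fun k => fc (m + k%:Z))
  (fun k => fj (m + k%:Z)) xy l0 H.
by exists tau => //; move: ctau; rewrite addrK.
Qed.

(* Moving the start to the left costs at most the jump of the first line,
   which has the right sign. *)
Lemma metric_start_lsc (x : R) (n : int) (q : R * int) (c : R) :
  (c%:E < semidiscrete_metric f (x, n) q)%E ->
  exists2 delta, 0 < delta & forall x', x - delta < x' -> x' <= x ->
    (c%:E < semidiscrete_metric f (x', n) q)%E.
Proof.
case: q => [y m] /metric_gtP[xy mn [tau [t0 tle txN] ctau]].
have nE : m + `|n - m|%N%:Z = n by lia.
move: ctau; rewrite /path_value nE => ctau.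
set S := (X in X + _) in ctau.
have eta0 : 0 < S + (f n (tau `|n - m|%N) - f n x) - c by rewrite subr_gt0.
have /nbhs_ballP[delta /= delta0 fx] := cadlag_near x (fc n) (fj n) eta0.
exists delta => // x' x'd x'x; apply/metric_gtP; split=> //.
  exact: le_trans xy.
exists tau; first by split=> //; exact: le_trans txN.
rewrite /path_value nE -/S.
have /fx/andP[_] : ball x delta x'.
  by rewrite /ball/= ltr_distlC; apply/andP; split; lra.
by lra.
Qed.

(** Only the time at which the bottom line is left moves, so the value changes by [f m y' - f m y],
    which is small by right continuity. *)
Lemma metric_end_lsc (p : R * int) (y : R) (m : int) (c : R) :
  (c%:E < semidiscrete_metric f p (y, m))%E ->
  exists2 delta, 0 < delta & forall y', y <= y' -> y' < y + delta ->
    (c%:E < semidiscrete_metric f p (y', m))%E.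
Proof.
case: p => [x n] /metric_gtP[xy mn [tau [t0 tle txN] ctau]].
set N := `|n - m|%N in tle txN ctau *.
set h := (X in path_value X) in ctau.
have eta0 : 0 < path_value h N x tau - c by rewrite subr_gt0.
have [delta delta0 fd] := cadlag_right y (fc m) eta0.
exists delta => // y' yy' y'd; apply/metric_gtP; split=> //.
  exact: le_trans yy'.
pose tau' k := if k is j.+1 then tau j.+1 else y'.
exists tau'.
  split=> //.
    by case=> [|k] kN /=; [apply: le_trans yy'; rewrite -t0; exact: tle|exact: tle].
  by rewrite -/N; case: (N) txN => //= _; exact: le_trans yy'.
rewrite -/N -/h.
have -> : path_value h N x tau' = path_value h N x tau + (f m y' - f m y).
  have h0 : h 0%N = f m by rewrite /h addr0.
  rewrite /path_value; case: (N) => [|K].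
    by rewrite !big_nil /= h0 t0; ring.
  by rewrite !big_nat_recl//= h0 t0; ring.
have := fd _ yy' y'd; rewrite ltr_distl => /andP[+ _].
by lra.
Qed.

End metric_pathwise.

(** * Reduction to countable sets of starting and end points *)

Lemma countable_choice (C : countType) (Z : Type) (Q : C -> Z -> Prop) :
  exists e : nat -> option Z,
    (forall i z, e i = Some z -> exists c, Q c z) /\
    (forall c, (exists z, Q c z) -> exists i z, e i = Some z /\ Q c z).
Proof.
have /choice[g gP] : forall c, exists o : option Z,
    if o is Some z then Q c z else ~ exists z, Q c z.
  move=> c; have [[z cz]|nz] := pselect (exists z, Q c z).
    by exists (Some z).
  by exists None.
exists (fun i => obind g (unpickle i)); split=> [i z|c].
  by case: (unpickle i) => //= c cz; exists c; have := gP c; rewrite cz.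
move=> cz; exists (pickle c); rewrite pickleK /=.
by have := gP c; case: (g c) => [z|] // cz'; exists z.
Qed.

(** Approximation is from the left and on the same line, the direction in which [metric_start_lsc]
    allows a starting point to move. The value [None] accommodates an empty [A]. *)
Definition left_enum (R : realType) (A : set (R * int))
    (e : nat -> option (R * int)) : Prop :=
  (forall i z, e i = Some z -> A z) /\
  forall x n delta, A (x, n) -> 0 < delta ->
    exists i x', [/\ e i = Some (x', n), x - delta < x' & x' <= x].

Definition right_enum (R : realType) (A : set (R * int))
    (e : nat -> option (R * int)) : Prop :=
  (forall i z, e i = Some z -> A z) /\
  forall x n delta, A (x, n) -> 0 < delta ->
    exists i x', [/\ e i = Some (x', n), x <= x' & x' < x + delta].

(* Countably many points are isolated from the left; each is the least element
   of a half-line of the set with rational endpoint. *)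
Lemma left_enum_exists (R : realType) (A : set (R * int)) :
  exists e, left_enum A e.
Proof.
(* The code [inr] asks for any point in a rational interval, [inl] for the least point to the right
   of a rational number. *)
pose Q (c : int * (rat + rat * rat)) (z : R * int) := A z /\ z.2 = c.1 /\
  match c.2 with
  | inl q => ratr q < z.1 /\ forall w, A (w, c.1) -> ratr q < w -> z.1 <= w
  | inr q => ratr q.1 < z.1 < ratr q.2
  end.
have [e [eA eQ]] := countable_choice Q.
exists e; split=> [i z /eA[c []]//|x n delta Ax delta0].
have [[w [Aw xw wx]]|nw] := pselect (exists w, [/\ A (w, n), x - delta < w & w < x]).
  have [q1] := rat_in_itvoo xw; rewrite in_itv/= => /andP[xq1 q1w].
  have [q2] := rat_in_itvoo wx; rewrite in_itv/= => /andP[wq2 q2x].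
  have [|i [[x' n'] [ez [_ [/= nn /andP[h1 h2]]]]]] := eQ (n, inr (q1, q2)).
    by exists (w, n); split=> //; split=> //=; rewrite q1w.
  by rewrite nn in ez; exists i, x'; split=> //; lra.
have xd : x - delta < x by rewrite gtrBl.
have [q] := rat_in_itvoo xd; rewrite in_itv/= => /andP[xq qx].
have [|i [[x' n'] [ez [_ [/= nn [h1 h2]]]]]] := eQ (n, inl q).
  exists (x, n); split=> //; split=> //=; split=> // w Aw qw.
  by rewrite leNgt; apply/negP => wx; apply: nw; exists w; split=> //; lra.
by rewrite nn in ez; exists i, x'; split=> //; [lra|exact: h2].
Qed.

Lemma right_enum_exists (R : realType) (A : set (R * int)) :
  exists e, right_enum A e.
Proof.
(* Reflection of time exchanges left and right. *)
have [e [eA eD]] := left_enum_exists [set z : R * int | A (- z.1, z.2)].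
exists (fun i => omap (fun z : R * int => (- z.1, z.2)) (e i)).
split=> [i z|x n delta Ax delta0].
  by case ei : (e i) => [[x n]|] //= [<-]; exact: (eA _ _ ei).
have [|i [x' [ei h1 h2]]] := eD (- x) n delta _ delta0; first by rewrite /= opprK.
by exists i, (- x'); rewrite ei /=; split=> //; lra.
Qed.

(** A strict bound survives moving first the starting point, then the end point, to listed points.
    The event thus becomes an increasing union, over [N], of events about finite sets. *)
Lemma set_to_set_gtP (R : realType) (f : int -> R -> R) (A B : set (R * int))
    (eA eB : nat -> option (R * int)) (c : R) :
  (forall i, cadlag (f i)) -> (forall i, no_negative_jump (f i)) ->
  left_enum A eA -> right_enum B eB ->
  (c%:E < set_to_set (semidiscrete_metric f) A B)%E <->
  exists N : nat, exists2 a, a \in pmap eA (iota 0 N) &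
    exists2 b, b \in pmap eB (iota 0 N) & (c%:E < semidiscrete_metric f a b)%E.
Proof.
move=> fc fj [eA1 eA2] [eB1 eB2]; split.
  move=> /ereal_sup_gt[_ [[[x n] [y m]] [Ax By] <-]].
  move=> /(metric_start_lsc fc fj)[d1 d10 H1].
  have [i [x' [ei h1 h2]]] := eA2 _ _ _ Ax d10.
  have /(metric_end_lsc fc)[d2 d20 H2] := H1 _ h1 h2.
  have [j [y' [ej h3 h4]]] := eB2 _ _ _ By d20.
  exists (maxn i j).+1; exists (x', n).
    by rewrite mem_pmap -ei; apply: map_f; rewrite mem_iota; lia.
  exists (y', m); last exact: H2.
  by rewrite mem_pmap -ej; apply: map_f; rewrite mem_iota; lia.
move=> [N [a + [b + cab]]]; rewrite !mem_pmap.
move=> /mapP[i _ /esym/eA1 Aa] /mapP[j _ /esym/eB1 Bb].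
by apply: lt_le_trans cab _; apply: ereal_sup_ubound; exists (a, b).
Qed.

(** * Independence *)

Section independence.
Context (d : measure_display) (T : measurableType d) (R : realType).
Variable P : probability T R.

Definition indep_classes (G H : set_system T) : Prop :=
  forall A B, G A -> H B -> P (A `&` B) = (P A * P B)%E.

Lemma indep_classesC (G H : set_system T) :
  indep_classes G H -> indep_classes H G.
Proof. by move=> GH A B HA GB; rewrite setIC muleC; exact: GH. Qed.

(** Pi-lambda argument: for fixed [B] in [H], the events that factor with [B] form a Dynkin system
    containing [G]. *)
Lemma indep_sigma_l (G H : set_system T) :
  setI_closed G -> G `<=` measurable -> H `<=` measurable ->
  indep_classes G H -> indep_classes <<s G >> H.
Proof.
move=> GI Gm Hm GH A B + HB.
have mB := Hm _ HB.
have PBfin : P B \is a fin_num by exact: fin_num_measure.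
suff : <<s G >> `<=` [set A | measurable A /\ P (A `&` B) = (P A * P B)%E].
  by move=> /[apply] -[].
rewrite -(setI_closed_g_dynkin_g_sigma_algebra GI); apply: smallest_sub; last first.
  by move=> C GC; split; [exact: Gm|exact: GH].
split.
- by split=> //; rewrite setTI probability_setT mul1e.
- move=> C [mC CB]; split; first exact: measurableC.
  rewrite probability_setC// muleBl ?fin_num_adde_defr// mul1e -CB.
  rewrite setIC -setDE measureD//; first by rewrite setIC.
  by rewrite ltey_eq PBfin.
- move=> F tF FB; have mF k : measurable (F k) by case: (FB k).
  split; first exact: bigcup_measurable.
  rewrite setI_bigcupl !measure_bigcup//=; last 2 first.
  + by move=> i _; exact: measurableI.
  + exact: trivIset_setIr.
  rewrite muleC -(fineK PBfin) -nneseriesZl//.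
  by apply: eq_eseriesr => k _; rewrite (FB k).2 fineK// muleC.
Qed.

Lemma indep_sigma (G H : set_system T) :
  setI_closed G -> setI_closed H -> G `<=` measurable -> H `<=` measurable ->
  indep_classes G H -> indep_classes <<s G >> <<s H >>.
Proof.
move=> GI HI Gm Hm GH; apply/indep_classesC/indep_sigma_l => //.
  by apply: smallest_sub => //; exact: sigma_algebra_measurable.
by apply/indep_classesC/indep_sigma_l.
Qed.

(** Fatou's lemma for sets: [E] is the increasing union of its intersections with the events that
    [En n] holds for all [n >= N]. *)
Lemma prob_liminf (E : set T) (En : nat -> set T) (eta : R) :
  measurable E -> (forall n, measurable (En n)) -> 0 < eta ->
  (forall w, E w -> \forall n \near \oo, En n w) ->
  \forall n \near \oo, fine (P E) <= fine (P (En n)) + eta.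
Proof.
move=> mE mEn eta0 EEn.
pose G N := E `&` \bigcap_(n in [set n | (N <= n)%N]) En n.
have mG N : measurable (G N).
  by apply: measurableI => //; apply: bigcap_measurableType.
have GE : \bigcup_N G N = E.
  apply/seteqP; split=> [w [N _ []]//|w Ew].
  by have [N _ NE] := EEn _ Ew; exists N => //; split=> // n /NE.
have ndG : nondecreasing_seq G.
  move=> N M NM; apply/subsetPset => w [Ew H]; split=> // n /= Mn.
  by apply: H => /=; exact: leq_trans Mn.
have := @nondecreasing_cvg_mu _ _ _ P G mG _ ndG.
rewrite GE => /(_ mE) PG.
have /fine_cvgP[_] : P \o G @ \oo --> (fine (P E))%:E.
  by rewrite fineK ?fin_num_measure.
move=> /cvgrPdist_lt/(_ _ eta0) [N _ NP].
exists N => // n /= Nn; have := NP _ (leqnn N).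
rewrite /= ltr_distl => /andP[_ /ltW]; move=> /le_trans; apply.
rewrite lerD2r fine_le ?fin_num_measure//.
by apply: le_measure; rewrite ?inE// => w [_ /(_ n Nn)].
Qed.

Lemma prob_limsup (E : set T) (En : nat -> set T) (eta : R) :
  measurable E -> (forall n, measurable (En n)) -> 0 < eta ->
  (forall w, ~ E w -> \forall n \near \oo, ~ En n w) ->
  \forall n \near \oo, fine (P (En n)) <= fine (P E) + eta.
Proof.
move=> mE mEn eta0 EEn.
have := @prob_liminf (~` E) (fun n => ~` En n) eta (measurableC mE)
  (fun n => measurableC (mEn n)) eta0 EEn.
apply: filterS => n; rewrite !probability_setC// !fineB ?fin_num_measure//=.
by lra.
Qed.

End independence.

Section limits_of_independent_events.
Context (d : measure_display) (T : measurableType d) (R : realType).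
Variable P : probability T R.

(* Events [A e] and [An n e], loosely [X <= r + e] and [Xn <= r + e] with
   [Xn --> X], are compared up to an increase of [e]. *)
Record event_cvg (A : R -> set T) (An : nat -> R -> set T) : Prop := EventCvg {
  event_cvg_measurable : forall e, measurable (A e);
  event_cvg_measurable_n : forall n e, measurable (An n e);
  event_cvg_low : forall e e' w, e < e' -> A e w ->
    \forall n \near \oo, An n e' w;
  event_cvg_up : forall e e' w, e < e' -> ~ A e' w ->
    \forall n \near \oo, ~ An n e w;
  event_cvg_right : forall w, ~ A 0 w ->
    \forall m \near \oo, ~ A m.+1%:R^-1 w }.

Lemma event_cvgT : event_cvg (fun=> setT) (fun _ _ => setT).
Proof. by split=> // *; exact: nearW. Qed.

Lemma event_cvgI A An B Bn : event_cvg A An -> event_cvg B Bn ->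
  event_cvg (fun e => A e `&` B e) (fun n e => An n e `&` Bn n e).
Proof.
move=> [mA mAn Al Au Ar] [mB mBn Bl Bu Br]; split=> [e|n e|e e' w ee'|e e' w ee'|w].
- exact: measurableI.
- exact: measurableI.
- by move=> [Aw Bw]; exact: filterI (Al _ _ _ ee' Aw) (Bl _ _ _ ee' Bw).
- move=> /not_andP[/(Au _ _ _ ee')|/(Bu _ _ _ ee')]; apply: filterS => n.
    by move=> nA [].
  by move=> nA [].
- move=> /not_andP[/Ar|/Br]; apply: filterS => n.
    by move=> nA [].
  by move=> nA [].
Qed.

Lemma event_cvg_le (X : T -> R) (Xn : nat -> T -> R) (r : R) :
  measurable_fun setT X -> (forall n, measurable_fun setT (Xn n)) ->
  (forall w, Xn n w @[n --> \oo] --> X w) ->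
  event_cvg (fun e => [set w | X w <= r + e]) (fun n e => [set w | Xn n w <= r + e]).
Proof.
have mle (Y : T -> R) c : measurable_fun setT Y -> measurable [set w | Y w <= c].
  move=> mY; rewrite [X in measurable X](_ : _ = setT `&` Y @^-1` `]-oo, c]).
    by apply: mY => //; exact: measurable_itv.
  by rewrite setTI; apply/seteqP; split=> w /=; rewrite in_itv.
move=> mX mXn XnX; split=> [e|n e|e e' w ee' /= Xw|e e' w ee' /= /negP|w /= /negP].
- exact: mle.
- exact: mle.
- have ee0 : 0 < e' - e by rewrite subr_gt0.
  have /cvgrPdist_lt/(_ _ ee0) := XnX w.
  by apply: filterS => n; rewrite ltr_distl; lra.
- rewrite -ltNge => Xw; have ee0 : 0 < e' - e by rewrite subr_gt0.
  have /cvgrPdist_lt/(_ _ ee0) := XnX w.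
  by apply: filterS => n; rewrite ltr_distl => h; apply/negP; rewrite -ltNge; lra.
- rewrite -ltNge addr0 => rX; have rX0 : 0 < X w - r by rewrite subr_gt0.
  apply: filterS (near_infty_natSinv_lt (PosNum rX0)) => n /= h.
  by apply/negP; rewrite -ltNge -ltrBrDl.
Qed.

(** Up to small errors, the probability of [An n (e / 2)] lies between those of [A 0] and [A e], and
    these two are close for small [e]. Shifting the threshold copes with limits that have an atom at
    it. *)
Lemma event_cvg_indep A An B Bn : event_cvg A An -> event_cvg B Bn ->
  (\forall n \near \oo, forall e,
    P (An n e `&` Bn n e) = (P (An n e) * P (Bn n e))%E) ->
  P (A 0%R `&` B 0%R) = (P (A 0%R) * P (B 0%R))%E.
Proof.
move=> cA cB ind; have cC := event_cvgI cA cB.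
have near_e X Xn eta : event_cvg X Xn -> 0 < eta ->
    \forall m \near \oo, fine (P (X m.+1%:R^-1)) <= fine (P (X 0)) + eta.
  move=> [mX _ _ _ Xr] eta0.
  by apply: (@prob_limsup _ _ _ P _ (fun m => X m.+1%:R^-1)).
have near_n X Xn eta e : event_cvg X Xn -> 0 < eta -> 0 < e ->
    \forall n \near \oo, fine (P (X 0)) <= fine (P (Xn n (e / 2))) + eta /\
      fine (P (Xn n (e / 2))) <= fine (P (X e)) + eta.
  move=> [mX mXn Xl Xu _] eta0 e0; apply: filterI.
    apply: (@prob_liminf _ _ _ P (X 0) (fun n => Xn n (e / 2))) => // w.
    by apply: Xl; rewrite divr_gt0.
  apply: (@prob_limsup _ _ _ P (X e) (fun n => Xn n (e / 2))) => // w.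
  by apply: Xu; rewrite ltr_pdivrMr// ltr_pMr// ltr1n.
(* The sandwich puts the probabilities of the events at [n] within [2 * eta] of those at the limit;
   the intersection contributes [2 * eta] and the product [4 * eta]. *)
have key eta : 0 < eta ->
    `|fine (P (A 0 `&` B 0)) - fine (P (A 0)) * fine (P (B 0))| <= 6 * eta.
  move=> eta0.
  have [m [[Am Bm] Cm]] := filter_ex (filterI (filterI
    (near_e _ _ _ cA eta0) (near_e _ _ _ cB eta0)) (near_e _ _ _ cC eta0)).
  set e := m.+1%:R^-1 in Am Bm Cm.
  have e0 : 0 < e :> R by rewrite invr_gt0.
  have [n [[[[A1 A2] [B1 B2]] [C1 C2]] In]] := filter_ex (filterI (filterI (filterI
    (near_n _ _ _ _ cA eta0 e0) (near_n _ _ _ _ cB eta0 e0))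
    (near_n _ _ _ _ cC eta0 e0)) ind).
  have mA := event_cvg_measurable_n cA n (e / 2).
  have mB := event_cvg_measurable_n cB n (e / 2).
  move: C1 C2; rewrite (In (e / 2)) fineM ?fin_num_measure//.
  have p01 E : measurable E -> 0 <= fine (P E) <= 1.
    move=> mE; rewrite fine_ge0//=.
    by rewrite -lee_fin fineK ?fin_num_measure// probability_le1.
  have /andP[] := p01 _ mA; have /andP[] := p01 _ mB.
  have /andP[] := p01 _ (event_cvg_measurable cA 0).
  have /andP[] := p01 _ (event_cvg_measurable cB 0).
  move: Am Bm Cm A1 A2 B1 B2.
  set a := fine (P (A 0)); set b := fine (P (B 0)).
  set an := fine (P (An n _)); set bn := fine (P (Bn n _)).
  set c := fine (P (A 0 `&` B 0)) => *.
  have h1 : an * (bn - b) <= 2 * eta by nra.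
  have h2 : b * (an - a) <= 2 * eta by nra.
  have h3 : - (2 * eta) <= an * (bn - b) by nra.
  have h4 : - (2 * eta) <= b * (an - a) by nra.
  by rewrite ler_norml; apply/andP; split; lra.
have mA := event_cvg_measurable cA 0; have mB := event_cvg_measurable cB 0.
have mAB := measurableI _ _ mA mB.
rewrite -[LHS]fineK ?fin_num_measure// -[RHS]fineK; last first.
  by rewrite fin_numM ?fin_num_measure.
congr EFin; rewrite fineM ?fin_num_measure//.
apply/eqP; rewrite -subr_eq0 -normr_le0; apply/ler_addgt0Pr => e e0.
rewrite add0r; have e60 : 0 < e / 6 by rewrite divr_gt0.
apply: le_trans (key _ e60) _.
by rewrite mulrC divfK.
Qed.

End limits_of_independent_events.

Section blocks.
Context (d : measure_display) (T : measurableType d) (R : realType).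
Variable P : probability T R.
Context (I : finType) (X : I -> T -> R).
Hypothesis mX : forall i, measurable_fun setT (X i).

(** Cylinder events of the variables indexed by [C], a pi-system. Keeping all indices, with the full
    set outside [C], makes the intersection of two complementary blocks an event to which the
    product formula applies directly. *)
Definition block (C : pred I) : set_system T :=
  [set E | exists B : I -> set R, [/\ forall i, measurable (B i),
     forall i, ~~ C i -> B i = setT &
     E = \bigcap_(i in [set: I]) X i @^-1` B i]].

Lemma measurable_preim i B : measurable B -> measurable (X i @^-1` B).
Proof. by move=> mB; rewrite -[_ @^-1` _]setTI; exact: mX. Qed.

Lemma block_measurable C : block C `<=` measurable.
Proof.
move=> E [B [mB _ ->]]; apply: fin_bigcap_measurable => // i _.
exact: measurable_preim.
Qed.

Lemma block_setI C : setI_closed (block C).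
Proof.
move=> E E' [B [mB BT ->]] [B' [mB' BT' ->]].
exists (fun i => B i `&` B' i); split=> [i|i Ci|].
- exact: measurableI.
- by rewrite BT// BT'// setIT.
- by rewrite -bigcapI.
Qed.

Lemma block_indep (C : pred I) :
  (forall B : I -> set R, (forall i, measurable (B i)) ->
    P (\bigcap_(i in [set: I]) X i @^-1` B i) = (\prod_i P (X i @^-1` B i))%E) ->
  indep_classes P <<s block C >> <<s block (predC C) >>.
Proof.
move=> ind; apply: indep_sigma; [exact: block_setI|exact: block_setI| | |].
- exact: block_measurable.
- exact: block_measurable.
move=> E E' [B [mB BT ->]] [B' [mB' BT' ->]].
have -> : \bigcap_(i in [set: I]) X i @^-1` B i `&`
    \bigcap_(i in [set: I]) X i @^-1` B' i =
    \bigcap_(i in [set: I]) X i @^-1` (B i `&` B' i) by rewrite -bigcapI.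
rewrite !ind//; last by move=> i; exact: measurableI.
rewrite -big_split /=; apply: eq_bigr => i _.
have [Ci|nCi] := boolP (C i).
  by rewrite (BT' i) /= ?Ci// setIT preimage_setT probability_setT mule1.
by rewrite BT// setTI preimage_setT probability_setT mul1e.
Qed.

Lemma block_linear_le (C : pred I) (k : I -> R) (c : R) :
  (forall i, ~~ C i -> k i = 0) ->
  <<s block C >> [set w | \sum_i k i * X i w <= c].
Proof.
move=> kC; pose S := g_sigma_algebraType (block C).
have mS : measurable_fun [set: S] (fun w : S => \sum_i k i * X i w : R).
  apply: measurable_sum => i.
  have [Ci|nCi] := boolP (C i); last first.
    by under eq_fun do rewrite kC// mul0r; exact: measurable_cst.
  apply: measurable_funM; first exact: measurable_cst.
  move=> _ B mB; rewrite setTI; apply: sub_sigma_algebra.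
  exists (fun j => if j == i then B else setT); split=> [j|j|].
  - by case: ifP.
  - by case: ifPn => // /eqP -> /negP.
  - apply/seteqP; split=> [w Bw j _ /=|w /(_ i Logic.I)/=]; last by rewrite eqxx.
    by case: ifPn => // /eqP ->.
have := mS measurableT `]-oo, c]%classic (measurable_itv _).
by rewrite setTI; congr (<<s _ >> _).
Qed.

End blocks.

(** * Independence of the past and the future of a point *)

Section past_and_future.
Context (disp : measure_display) (T : measurableType disp) (R : realType).
Variables (P : probability T R) (F : int -> R -> {RV P >-> R}).

(* [(j, t, u, r)] stands for the event [F_j(t) - F_j(u) <= r]. *)
Definition increment_le (e : R) (q : int * R * R * R) : set T :=
  [set w | F q.1.1.1 q.1.1.2 w - F q.1.1.1 q.1.2 w <= q.2 + e].

Definition increments_le (e : R) (l : seq (int * R * R * R)) : set T :=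
  foldr (fun q E => increment_le e q `&` E) setT l.

(** Independence is assumed for increments, so these generate the class rather than values of [F].
    Lists make it stable under intersection. In a region the line comes first and the time second,
    opposite to points. *)
Definition region_class (D : set (int * R)) : set_system T :=
  [set E | exists2 l, (forall q, q \in l ->
      D (q.1.1.1, q.1.1.2) /\ D (q.1.1.1, q.1.2)) & E = increments_le 0 l].

Definition past (a : R * int) : set (int * R) :=
  [set z | a.2 < z.1 \/ z.1 = a.2 /\ z.2 <= a.1].

Definition future (a : R * int) : set (int * R) :=
  [set z | z.1 < a.2 \/ z.1 = a.2 /\ a.1 <= z.2].

Lemma measurable_increment_le e q : measurable (increment_le e q).
Proof.
rewrite /increment_le.
have mF : measurable_fun [set: T]
    (fun w => F q.1.1.1 q.1.1.2 w - F q.1.1.1 q.1.2 w) by exact: measurable_funB.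
have := mF measurableT `]-oo, q.2 + e]%classic (measurable_itv _).
by rewrite setTI; congr measurable.
Qed.

Lemma region_class_measurable D : region_class D `<=` measurable.
Proof.
move=> _ [l _ ->]; elim: l => [|q l IH] /=; first exact: measurableT.
by apply: measurableI => //; exact: measurable_increment_le.
Qed.

Lemma region_class_setI D : setI_closed (region_class D).
Proof.
move=> _ _ [l lD ->] [l' lD' ->]; exists (l ++ l').
  by move=> q; rewrite mem_cat => /orP[/lD|/lD'].
elim: l {lD} => [|q l IH] /=; first by rewrite setTI.
by rewrite -setIA IH.
Qed.

Section grid.
Variables (g : seq R) (J : seq int).
Hypothesis g_sorted : sorted <%R g.
Let L := (size g).-1.
Let I : finType := (seq_sub J * 'I_L)%type.
Let lo (i : I) : R := nth 0 g i.2.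
Let hi (i : I) : R := nth 0 g i.2.+1.

(* The gap of length [1 / (n + 1)] makes consecutive cells disjoint. *)
Definition gap_increment (n : nat) (i : I) (w : T) : R :=
  F (ssval i.1) (hi i) w - F (ssval i.1) (lo i + n.+1%:R^-1) w.

(** The indicator of the cells to the left of [t] minus that of the cells to the left of [u], so
    that [t < u] is covered as well. *)
Definition cell_coef (q : int * R * R * R) (i : I) : R :=
  if ssval i.1 == q.1.1.1 then (hi i <= q.1.1.2)%R%:R - (hi i <= q.1.2)%R%:R
  else 0.

Lemma grid_lt (i j : nat) : (i < j)%N -> (j < size g)%N -> nth 0 g i < nth 0 g j.
Proof.
move=> ij js; have := sorted_ltn_nth lt_trans 0 g_sorted; apply=> //.
by rewrite inE; exact: ltn_trans js.
Qed.

Lemma lo_lt_hi i : lo i < hi i.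
Proof. by apply: grid_lt => //; have := ltn_ord i.2; rewrite /L; lia. Qed.

Lemma grid_le (i j : nat) : (i <= j)%N -> (j < size g)%N -> nth 0 g i <= nth 0 g j.
Proof.
rewrite leq_eqVlt => /orP[/eqP -> //|ij js].
by rewrite ltW// grid_lt.
Qed.

Lemma measurable_gap_increment n i : measurable_fun setT (gap_increment n i).
Proof. exact: measurable_funB. Qed.

Lemma gap_indep (n : nat) : independent_increments F ->
  (forall i : I, lo i + n.+1%:R^-1 <= hi i) ->
  forall B : I -> set R, (forall i, measurable (B i)) ->
    P (\bigcap_(i in [set: I]) gap_increment n i @^-1` B i) =
    (\prod_i P (gap_increment n i @^-1` B i))%E.
Proof.
move=> indF gap B mB; pose i_ (k : 'I_#|I|) : I := enum_val k.
have := indF _ (fun k => lo (i_ k) + n.+1%:R^-1) (fun k => hi (i_ k))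
  (fun k => ssval (i_ k).1) (fun k => gap (i_ k)).
move=> /(_ _ (fun k => B (i_ k)) (fun k => mB (i_ k))) H.
rewrite (reindex_onto (enum_val : 'I_#|I| -> I) enum_rank)/=; last first.
  by move=> i _; rewrite enum_rankK.
under eq_bigl do rewrite enum_valK eqxx.
rewrite -H.
  congr (P _); apply/seteqP; split=> w Hw i _; first exact: (Hw (i_ i)).
  by have := Hw (enum_rank i) Logic.I; rewrite /i_ enum_rankK.
move=> k k' _ _ [[t j] [[/= tk jk] [/= tk' jk']]].
apply: enum_val_inj; rewrite -/(i_ k) -/(i_ k').
move: tk tk' jk jk'; rewrite !in_itv/=; case: (i_ k) => [z l]; case: (i_ k') => [z' l'] /=.
rewrite /lo /hi/= => /andP[h1 h2] /andP[h3 h4] jz jz'.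
have zz : z = z' by apply: val_inj; rewrite /= -jz -jz'.
have n0 : 0 < n.+1%:R^-1 :> R by rewrite invr_gt0.
(* On a common line, the gap separates the interval of a later cell from that of an earlier one. *)
have aux (a b : 'I_L) : (a < b)%N -> nth 0 g b + n.+1%:R^-1 <= t -> t <= nth 0 g a.+1 -> False.
  move=> ab bt ta; have : nth 0 g a.+1 <= nth 0 g b.
    by apply: grid_le => //; have := ltn_ord b; rewrite /L; lia.
  move=> gab; have := le_trans bt (le_trans ta gab).
  by rewrite leNgt ltrDl n0.
rewrite zz; congr (_, _); apply: val_inj => /=.
by case: (ltngtP l l') => // ll'; exfalso; [exact: aux ll' h3 h2|exact: aux ll' h1 h4].
Qed.

(** Both times are compared with the first grid point, from which the increments telescope; cells on
    other lines have coefficient zero. *)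
Lemma cell_coef_sum (f : int -> R -> R) (q : int * R * R * R) :
  q.1.1.1 \in J -> q.1.1.2 \in g -> q.1.2 \in g ->
  \sum_i cell_coef q i * (f (ssval i.1) (hi i) - f (ssval i.1) (lo i)) =
  f q.1.1.1 q.1.1.2 - f q.1.1.1 q.1.2.
Proof.
case: q => [[[j t] u] r] /= jJ tg ug.
have teleE a : (a < size g)%N -> \sum_(l < L) (nth 0%R g l.+1 <= nth 0%R g a)%R%:R *
    (f j (nth 0 g l.+1) - f j (nth 0 g l)) = f j (nth 0 g a) - f j (nth 0 g 0).
  move=> ag; have aL : (a <= L)%N by rewrite /L; lia.
  rewrite -(big_mkord xpredT (fun l => (nth 0%R g l.+1 <= nth 0%R g a)%R%:R *
    (f j (nth 0 g l.+1) - f j (nth 0 g l)))) (big_cat_nat (leq0n a) aL)/=.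
  rewrite [X in _ + X](_ : _ = 0) ?addr0; last first.
    rewrite big_nat_cond; apply: big1 => l /andP[/andP[al lL] _].
    rewrite leNgt grid_lt ?mul0r//.
    by move: lL; rewrite /L; lia.
  rewrite -(telescope_sumr (fun l => f j (nth 0 g l)) (leq0n a)).
  apply: eq_big_nat => l /andP[_ la].
  by rewrite grid_le ?mul1r.
have -> : f j t - f j u = (f j t - f j (nth 0 g 0)) - (f j u - f j (nth 0 g 0)).
  by ring.
rewrite -[t](nth_index 0 tg) -[u](nth_index 0 ug) -!teleE ?index_mem//.
rewrite -sumrB /cell_coef /= /hi /lo.
rewrite -(pair_bigA _ (fun (z : seq_sub J) (l : 'I_L) =>
  (if ssval z == j then (nth 0%R g l.+1 <= nth 0 g (index t g))%R%:R -
     (nth 0%R g l.+1 <= nth 0 g (index u g))%R%:R else 0) *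
  (f (ssval z) (nth 0 g l.+1) - f (ssval z) (nth 0 g l))))/=.
rewrite (bigD1 (SeqSub jJ))//= [X in _ + X]big1 ?addr0; last first.
  move=> z zj; apply: big1 => l _; rewrite ifF ?mul0r//.
  by apply: contraNF zj => /eqP zj; apply/eqP/val_inj.
by apply: eq_bigr => l _; rewrite eqxx mulrBl.
Qed.

Lemma gap_sum_cvg (q : int * R * R * R) (w : T) :
  q.1.1.1 \in J -> q.1.1.2 \in g -> q.1.2 \in g ->
  (forall j, cadlag (fun t => F j t w)) ->
  \sum_i cell_coef q i * gap_increment n i w @[n --> \oo] -->
  F q.1.1.1 q.1.1.2 w - F q.1.1.1 q.1.2 w.
Proof.
move=> qJ tg ug Fc; rewrite -(cell_coef_sum (fun j t => F j t w) qJ tg ug).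
apply: cvg_big => [|i _]; first exact: add_continuous.
apply: cvgM; first exact: cvg_cst.
apply: cvgB; first exact: cvg_cst.
apply/cvgrPdist_lt => e e0.
have [dl dl0 fd] := cadlag_right (lo i) (Fc (ssval i.1)) e0.
apply: filterS (near_infty_natSinv_lt (PosNum dl0)) => n /= nd.
by rewrite distrC; apply: fd; rewrite ?lerDl ?ltrD2l.
Qed.

End grid.

(** Adjacent closed intervals share an end point, so independence is not assumed for their
    increments. It holds for cells shortened on the left; by right continuity the increments
    converge as the gap closes, and [event_cvg_indep] passes to the limit. *)
Lemma past_future_classes (a : R * int) : independent_environment F ->
  indep_classes P (region_class (past a)) (region_class (future a)).
Proof.
move=> [Fc _ indF] _ _ [l lD ->] [l' lD' ->].
pose g := sort <=%R (undup (flatten [seq [:: q.1.1.2; q.1.2] | q <- l ++ l'])).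
pose J := [seq q.1.1.1 | q <- l ++ l'].
have gs : sorted <%R g by rewrite /g sort_lt_sorted undup_uniq.
have memg q t : q \in l ++ l' -> t \in [:: q.1.1.2; q.1.2] -> t \in g.
  move=> ql tq; rewrite mem_sort mem_undup; apply/flattenP.
  by exists [:: q.1.1.2; q.1.2] => //; apply/mapP; exists q.
have memJ q : q \in l ++ l' -> q.1.1.1 \in J by move=> ql; apply: map_f.
pose I : finType := (seq_sub J * 'I_(size g).-1)%type.
(* The cells in the past of [a]. The time [a.1] need not be a grid point: a cell around it is left
   out here, and no past increment uses it. *)
pose C (i : I) := (a.2 < ssval i.1) || (ssval i.1 == a.2) && (nth 0 g i.2.+1 <= a.1).
pose gap n := @gap_increment g J n.
pose En (n : nat) (e : R) := foldr (fun q E =>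
  [set w | \sum_i cell_coef q i * gap n i w <= q.2 + e] `&` E) [set: T].
have mgap n i : measurable_fun setT (gap n i) by exact: measurable_gap_increment.
have En_cvg s : {subset s <= l ++ l'} ->
    event_cvg (fun e => increments_le e s) (fun n e => En n e s).
  elim: s => [|q s IH] sl /=; first exact: event_cvgT.
  have ql : q \in l ++ l' by apply: sl; rewrite inE eqxx.
  apply: event_cvgI; last first.
    by apply: IH => q' q's; apply: sl; rewrite inE q's orbT.
  apply: event_cvg_le.
  - exact: measurable_funB.
  - move=> n; apply: measurable_sum => i.
    by apply: measurable_funM; [exact: measurable_cst|exact: mgap].
  - move=> w; apply: (gap_sum_cvg gs (memJ _ ql)).
    + by apply: (memg q) => //; rewrite inE eqxx.
    + by apply: (memg q) => //; rewrite !inE eqxx orbT.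
    + by move=> j; exact: Fc.
have En_block n (D : pred I) e s :
    (forall q, q \in s -> forall i, ~~ D i -> cell_coef q i = 0) ->
    <<s block (gap n) D >> (En n e s).
  elim: s => [|q s IH] sD /=.
    exact: (@measurableT _ (g_sigma_algebraType (block (gap n) D))).
  apply: (@measurableI _ (g_sigma_algebraType (block (gap n) D))).
    by apply: block_linear_le => // i; apply: sD; rewrite inE eqxx.
  by apply: IH => q' q's; apply: sD; rewrite inE q's orbT.
apply: (event_cvg_indep (En_cvg l _) (En_cvg l' _)).
- by move=> q ql; rewrite mem_cat ql.
- by move=> q ql; rewrite mem_cat ql orbT.
have gap_near : \forall n \near \oo, forall i : I,
    nth 0 g i.2 + n.+1%:R^-1 <= nth 0 g i.2.+1.
  apply: filter_forall => i; have := lo_lt_hi gs i; rewrite -subr_gt0 => h0.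
  apply: filterS (near_infty_natSinv_lt (PosNum h0)) => n /= h.
  by rewrite -lerBrDl ltW.
apply: filterS gap_near => n gapn e.
apply: (block_indep (mgap n) (C := C) (gap_indep gs indF gapn)).
- apply: En_block => q ql i; rewrite /C negb_or negb_and -leNgt => /andP[ia iC].
  have [h1 h2] := lD _ ql; rewrite /cell_coef; case: eqP => // iq.
  case: h1 => /= [|[qa ta]]; first by rewrite -iq ltNge ia.
  case: h2 => /= [|[_ ua]]; first by rewrite -iq ltNge ia.
  move: iC; rewrite iq qa eqxx /= -ltNge => ahi.
  by rewrite !leNgt (le_lt_trans ta ahi) (le_lt_trans ua ahi) subrr.
(* On the line of [a], a cell ending by [a.1] lies to the left of both times of a future increment,
   so both indicators are one and cancel. In the previous case both were zero. *)
- apply: En_block => q ql i; rewrite /= negbK /C => iC.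
  have [h1 h2] := lD' _ ql; rewrite /cell_coef; case: eqP => // iq.
  case: h1 => /= [|[qa ta]]; first by move: iC; rewrite iq; case: ltgtP.
  case: h2 => /= [|[_ ua]]; first by rewrite qa ltxx.
  move: iC; rewrite iq qa ltxx eqxx /= => hia.
  by rewrite (le_trans hia ta) (le_trans hia ua) subrr.
Qed.

Lemma past_future_indep (a : R * int) : independent_environment F ->
  indep_classes P <<s region_class (past a) >> <<s region_class (future a) >>.
Proof.
move=> envF; apply: indep_sigma; last exact: past_future_classes.
- exact: region_class_setI.
- exact: region_class_setI.
- exact: region_class_measurable.
- exact: region_class_measurable.
Qed.

End past_and_future.

(** * Measurability of the metric in terms of increments in a region *)

Section metric_measurability.
Context (disp : measure_display) (T : measurableType disp) (R : realType).
Variables (P : probability T R) (F : int -> R -> {RV P >-> R}).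

Lemma measurable_increment (D : set (int * R)) (j : int) (t u : R) :
  D (j, t) -> D (j, u) ->
  measurable_fun [set: g_sigma_algebraType (region_class F D)]
    (fun w : g_sigma_algebraType (region_class F D) => F j t w - F j u w : R).
Proof.
move=> Dt Du; apply: (measurability _ (RGenOInfty.measurableE R)).
move=> _ [_ [r ->] <-]; rewrite setTI.
have -> : (fun w => F j t w - F j u w) @^-1` `]r, +oo[ =
    ~` increments_le F 0 [:: (j, t, u, r)].
  apply/seteqP; split=> w /=; rewrite in_itv/= andbT /increment_le/= addr0.
    by rewrite ltNge => /negP rF [].
  by move=> rF; rewrite ltNge; apply/negP => Fr; exact: rF.
apply: measurableC; apply: sub_sigma_algebra; exists [:: (j, t, u, r)] => //.
by move=> q; rewrite inE => /eqP ->.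
Qed.

(** By [metric_gt_approxP] the event is a countable combination of conditions on increments. Below
    line [n] the times in [D] have no lower bound, since entry times of approximate paths may
    precede [x]; this fits a future, which contains all lower lines entirely. *)
Lemma region_metric_gt (D : set (int * R)) (x y : R) (n m : int) (c : R) :
  independent_environment F ->
  (forall t, m <= n -> x <= t -> t <= y -> D (n, t)) ->
  (forall j t, m <= j -> j < n -> t <= y -> D (j, t)) ->
  <<s region_class F D >> [set w | (c%:E < random_metric F w (x, n) (y, m))%E].
Proof.
move=> [Fc Fj _] Dn Dj; pose S := g_sigma_algebraType (region_class F D).
have [/andP[xy mn]|nxy] := boolP ((x <= y) && (m <= n)); last first.
  rewrite (_ : [set w | _] = set0); first exact: (@measurable0 _ S).
  by apply/seteqP; split=> // w /metric_gtP[xy mn _]; rewrite xy mn in nxy.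
pose N := `|n - m|%N.
have nE : n = m + N%:Z by rewrite /N; lia.
pose V s w := approx_value (fun k t => F (m + k%:Z) t w) N x y s.
rewrite (_ : [set w | _] = \bigcup_(l : nat) \bigcap_(i : nat)
    \bigcup_(s : seq (rat * rat))
      [set w | approx_times N x y i.+1%:R^-1 s /\ c + l.+1%:R^-1 < V s w]).
  apply: (@bigcupT_measurable _ S) => l; apply: (@bigcapT_measurable _ S) => i.
  apply: (@countable_bigcupT_measurable _ S); first exact: countableP.
  move=> s; have [st|nst] := pselect (approx_times N x y i.+1%:R^-1 s); last first.
    rewrite (_ : [set w | _] = set0); first exact: (@measurable0 _ S).
    by apply/seteqP; split=> // w [].
  have mV : measurable_fun [set: S] (V s : S -> R).
    apply: measurable_funD.
      rewrite /V; under eq_fun do rewrite big_mkord.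
      apply: measurable_sum => k; have kN := ltn_ord k.
      have [_ _ _ h4] := st _ kN.
      have ry := approx_right_le y s.
      apply: measurable_increment; apply: Dj => //; try lia.
      exact: le_trans (ltW h4) (ry _).
    have rN : x <= approx_right y s N.
      by case: (N) st => [|K] st //; case: (st K (ltnSn K)).
    rewrite -nE; apply: measurable_increment; apply: Dn => //.
    exact: approx_right_le.
  rewrite (_ : [set w | _] = setT `&` V s @^-1` `]c + l.+1%:R^-1, +oo[).
    exact: mV.
  by rewrite setTI; apply/seteqP; split=> w /=; rewrite in_itv/= andbT => // -[].
apply/seteqP; split=> w.
  move=> /(metric_gt_approxP (Fc w) (Fj w))[_ _ [l H]]; exists l => // i _.
  by have [s sP] := H i; exists s.
move=> [l _ H]; apply/(metric_gt_approxP (Fc w) (Fj w)); split=> //.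
by exists l => i; have [s _ sP] := H i Logic.I; exists s.
Qed.

End metric_measurability.

(** * First hitting points and the theorem *)

Section first_hit.
Context (d : measure_display) (T : measurableType d) (R : realType).
Variable P : probability T R.
Context (X : eqType) (V L : X -> set T).

Definition hit (s : seq X) : set T := foldr (fun x E => V x `|` E) set0 s.

(* The first hitting point is searched from the end of the sequence. *)
Fixpoint first_hit (s : seq X) : set T :=
  if s is x :: s' then first_hit s' `|` (L x `&` (V x `\` hit s')) else set0.

Lemma hitP s w : hit s w <-> exists2 x, x \in s & V x w.
Proof.
elim: s => [|x s IH] /=; first by split=> // -[].
split=> [[Vx|/IH[y ys Vy]]|[y]]; first by exists x => //; rewrite inE eqxx.
  by exists y => //; rewrite inE ys orbT.
rewrite inE => /orP[/eqP ->|ys Vy]; first by left.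
by right; apply/IH; exists y.
Qed.

Lemma first_hitPn s w : hit s w -> ~ first_hit s w ->
  exists x, [/\ x \in s, V x w & ~ L x w].
Proof.
elim: s => [|x s IH] //= Vw /not_orP[nb nL].
have [sw|nsw] := pselect (hit s w).
  by have [y [ys Vy Ly]] := IH sw nb; exists y; split=> //; rewrite inE ys orbT.
exists x; split; first by rewrite inE eqxx.
  by case: Vw.
by move=> Lx; apply: nL; split=> //; split=> //; case: Vw.
Qed.

Lemma measurable_hit s : (forall x, measurable (V x)) -> measurable (hit s).
Proof.
by move=> mV; elim: s => [|x s IH] /=; [exact: measurable0|exact: measurableU].
Qed.

Lemma measurable_first_hit s : (forall x, measurable (V x)) ->
  (forall x, measurable (L x)) -> measurable (first_hit s).
Proof.
move=> mV mL; elim: s => [|x s IH] /=; first exact: measurable0.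
apply: measurableU => //; apply: measurableI => //; apply: measurableD => //.
exact: measurable_hit.
Qed.

(** The event that [x] is the first hit is [V x] minus the hits at later entries. As the list is
    sorted, it lies in [<<s H x>>] and is independent of [L x]; summing over [x] gives at most
    [alpha] times the probability of a hit, which is what the induction proves. *)
Lemma first_hit_bound (r : rel X) (G H : X -> set_system T) (s : seq X)
    (alpha : R) :
  reflexive r -> transitive r -> sorted r s ->
  (forall x, G x `<=` measurable) -> (forall x, H x `<=` measurable) ->
  (forall x, indep_classes P <<s G x >> <<s H x >>) ->
  (forall x, <<s G x >> (L x)) ->
  (forall x y, r x y -> <<s H x >> (V y)) ->
  (forall x, x \in s -> fine (P (L x)) <= alpha) -> 0 <= alpha ->
  fine (P (first_hit s)) <= alpha.
Proof.
move=> rr tr srt Gm Hm ind GL HV PL a0.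
have sub_m (K : set_system T) : K `<=` measurable -> <<s K >> `<=` measurable.
  by move=> Km; apply: smallest_sub => //; exact: sigma_algebra_measurable.
have mL x : measurable (L x) by apply: sub_m (GL x); exact: Gm.
have mV x : measurable (V x) by apply: sub_m (HV x x (rr x)); exact: Hm.
have p0 E : 0 <= fine (P E) by exact: fine_ge0.
suff : fine (P (first_hit s)) <= alpha * fine (P (hit s)).
  move=> /le_trans; apply; rewrite ler_piMr// -lee_fin fineK.
    by rewrite probability_le1//; exact: measurable_hit.
  by rewrite fin_num_measure//; exact: measurable_hit.
elim: s srt PL => [|x s IH] /= srt PL.
  by rewrite measure0 mulr0.
have mh := measurable_hit s mV; have mf := measurable_first_hit s mV mL.
have mVh : measurable (V x `\` hit s) by exact: measurableD.
have mLV : measurable (L x `&` (V x `\` hit s)) by exact: measurableI.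
have HVh : <<s H x >> (V x `\` hit s).
  apply: (@measurableD _ (g_sigma_algebraType (H x))); first exact: HV.
  move: srt; rewrite (path_sortedE tr) => /andP[/allP rs _].
  elim: s rs {IH PL mh mf mVh mLV} => [_|y s IH rs] /=.
    exact: (@measurable0 _ (g_sigma_algebraType (H x))).
  apply: (@measurableU _ (g_sigma_algebraType (H x))).
    by apply: HV; apply: rs; rewrite inE eqxx.
  by apply: IH => z zs; apply: rs; rewrite inE zs orbT.
have le1 : fine (P (first_hit s)) <= alpha * fine (P (hit s)).
  by apply: IH => [|y ys]; [exact: path_sorted srt|apply: PL; rewrite inE ys orbT].
have -> : V x `|` hit s = (V x `\` hit s) `|` hit s.
  apply/seteqP; split=> w [Vw|hw]; [|by right| by left; case: Vw|by right].
  by have [|] := pselect (hit s w); [right|left].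
have -> : P ((V x `\` hit s) `|` hit s) = (P (V x `\` hit s) + P (hit s))%E.
  by rewrite measureU//; apply/seteqP; split=> // w /= [[_ nh] hw].
rewrite fineD ?fin_num_measure// mulrDr addrC.
apply: (@le_trans _ _ (fine (P (first_hit s)) + fine (P (L x `&` (V x `\` hit s))))).
  rewrite -fineD ?fin_num_measure// fine_le ?fin_numD ?fin_num_measure//.
    exact: measurableU.
  exact: measureU2.
rewrite lerD// (ind x _ _ (GL x) HVh) fineM ?fin_num_measure//.
by rewrite ler_wpM2r// PL// inE eqxx.
Qed.

End first_hit.

(** * The bound for finite sets of points *)

Section bridge.
Context (disp : measure_display) (T : measurableType disp) (R : realType).
Variables (P : probability T R) (F : int -> R -> {RV P >-> R}).
Hypothesis envF : independent_environment F.

(* [b] lies in [future a], equivalently [a] lies in [past b]. *)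
Definition later (a b : R * int) : bool :=
  (b.2 < a.2) || (b.2 == a.2) && (a.1 <= b.1).

Lemma later_refl : reflexive later.
Proof. by move=> a; rewrite /later eqxx lexx orbT. Qed.

Lemma later_trans : transitive later.
Proof.
move=> [y m] [x n] [z k]; rewrite /later /=.
move=> /orP[mn|/andP[/eqP <- xy]] /orP[km|/andP[/eqP -> yz]].
- by rewrite (lt_trans km mn).
- by rewrite mn.
- by rewrite km.
- by rewrite eqxx (le_trans xy yz) orbT.
Qed.

Lemma later_total : total later.
Proof.
by move=> [x n] [y m]; rewrite /later /=; case: ltgtP => //= _; exact: le_total.
Qed.

(** Paths ending at [b] use no line below that of [b] and no time after [b.1]; they stay in
    [past b], which is contained in [past a]. *)
Lemma past_metric_gt (p a b : R * int) (c : R) : later b a ->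
  <<s region_class F (past a) >> [set w | (c%:E < random_metric F w p b)%E].
Proof.
case: p a b => [x n] [s k] [y m]; rewrite /later /= => yk.
apply: region_metric_gt => // [t mn _ ty|j t mj _ ty]; rewrite /past/=.
  case/orP: yk => [km|/andP[/eqP -> ys]]; first by left; exact: lt_le_trans mn.
  move: mn; rewrite le_eqVlt => /orP[/eqP <-|]; [right|left] => //.
  by split=> //; exact: le_trans ys.
case/orP: yk => [km|/andP[/eqP -> ys]]; first by left; exact: lt_le_trans mj.
move: mj; rewrite le_eqVlt => /orP[/eqP <-|]; [right|left] => //.
by split=> //; exact: le_trans ys.
Qed.

Lemma future_metric_gt (a b q : R * int) (c : R) : later a b ->
  <<s region_class F (future a) >> [set w | (c%:E < random_metric F w b q)%E].
Proof.
case: a b q => [s k] [x n] [y m]; rewrite /later /= => xk.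
apply: region_metric_gt => // [t _ xt _|j t _ jn _]; rewrite /future/=.
  case/orP: xk => [nk|/andP[/eqP -> sx]]; first by left.
  by right; split=> //; exact: le_trans xt.
left; case/orP: xk => [nk|/andP[/eqP <- _]] //.
exact: lt_trans nk.
Qed.

Lemma sigma_metric_le (G : set_system T) (p q : R * int) (c : R) :
  <<s G >> [set w | (c%:E < random_metric F w p q)%E] ->
  <<s G >> [set w | (random_metric F w p q <= c%:E)%E].
Proof.
move=> H; rewrite (_ : [set w | _] = ~` [set w | (c%:E < random_metric F w p q)%E]).
  exact: (@measurableC _ (g_sigma_algebraType G)).
by apply/seteqP; split=> w /=; rewrite leNgt => /negP.
Qed.

Lemma sigma_metric_lt (G : set_system T) (p q : R * int) (c : R) :
  (forall c' : R, <<s G >> [set w | (c'%:E < random_metric F w p q)%E]) ->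
  <<s G >> [set w | (random_metric F w p q < c%:E)%E].
Proof.
move=> H; rewrite (_ : [set w | _] = \bigcup_(l : nat)
    [set w | (random_metric F w p q <= (c - l.+1%:R^-1)%:E)%E]).
  apply: (@bigcupT_measurable _ (g_sigma_algebraType G)) => l.
  exact: sigma_metric_le.
apply/seteqP; split=> w /=; last first.
  move=> [l _ /= h]; apply: le_lt_trans h _.
  by rewrite lte_fin gtrBl invr_gt0.
case E : (random_metric F w p q) => [r| |]//; last by exists 0%N => //=; rewrite E leNye.
rewrite lte_fin => /lt_add_invS[l h]; exists l => //=.
by rewrite E lee_fin lerBrDr ltW.
Qed.

Lemma sigma_exists (G : set_system T) (X : eqType) (s : seq X) (E : X -> set T) :
  (forall x, <<s G >> (E x)) -> <<s G >> [set w | exists2 x, x \in s & E x w].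
Proof.
move=> HE; rewrite (_ : [set w | _] = hit E s).
  elim: s => [|x s IH] /=; first exact: (@measurable0 _ (g_sigma_algebraType G)).
  by apply: (@measurableU _ (g_sigma_algebraType G)); [exact: HE|exact: IH].
by apply/seteqP; split=> w /=; rewrite hitP.
Qed.

(** The complement of [d < - eps] gives only a weak bound. Slack taken from a strict bound turns it
    into a strict one, as the triangle inequality requires. *)
Lemma metric_gt_slack (p q : R * int) (c : R) w :
  (c%:E < random_metric F w p q)%E ->
  exists2 delta, 0 < delta & ((c + delta)%:E < random_metric F w p q)%E.
Proof.
case: p q => [x n] [y m] /metric_gtP[xy mn [tau taut ctau]].
have [l cl] := lt_add_invS ctau.
exists l.+1%:R^-1; first by rewrite invr_gt0.
by apply/metric_gtP; split=> //; exists tau.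
Qed.

Lemma metric_triangle_ge (p r q : R * int) (a b : R) w :
  (a%:E <= random_metric F w p r)%E -> (b%:E < random_metric F w r q)%E ->
  ((a + b)%:E < random_metric F w p q)%E.
Proof.
move=> pr /metric_gt_slack[delta delta0 rq].
rewrite (_ : a + b = (a - delta) + (b + delta)); last by ring.
apply: metric_triangle rq; apply: lt_le_trans pr.
by rewrite lte_fin gtrBl.
Qed.

Lemma metric_triangle_le (p r q : R * int) (a b : R) w :
  (a%:E < random_metric F w p r)%E -> (b%:E <= random_metric F w r q)%E ->
  ((a + b)%:E < random_metric F w p q)%E.
Proof.
move=> /metric_gt_slack[delta delta0 pr] rq.
rewrite (_ : a + b = (a + delta) + (b - delta)); last by ring.
apply: metric_triangle pr _; apply: lt_le_trans rq.
by rewrite lte_fin gtrBl.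
Qed.

Variables (p q : R * int) (c eps : R).

Lemma finite_bridge_bound (sA sB : seq (R * int)) (alpha beta : R) :
  0 <= alpha -> 0 <= beta ->
  (forall a, a \in sA ->
    fine (P [set w | (random_metric F w p a < (- eps)%:E)%E]) <= alpha) ->
  (forall b, b \in sB ->
    fine (P [set w | (random_metric F w b q < (- eps)%:E)%E]) <= beta) ->
  let E := [set w | (random_metric F w p q <= (c - 2 * eps)%:E)%E /\
    exists2 a, a \in sA & exists2 b, b \in sB & (c%:E < random_metric F w a b)%E] in
  measurable E /\ fine (P E) <= alpha + beta.
Proof.
move=> alpha0 beta0 PA PB E.
have sub_m D : <<s region_class F D >> `<=` measurable.
  by apply: smallest_sub; [exact: sigma_algebra_measurable|exact: region_class_measurable].
have m_gt a b c' : measurable [set w | (c'%:E < random_metric F w a b)%E].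
  by apply: sub_m; apply: past_metric_gt; exact: later_refl.
pose VA a := [set w | exists2 b, b \in sB & (c%:E < random_metric F w a b)%E].
pose LA a := [set w | (random_metric F w p a < (- eps)%:E)%E].
pose VB b := [set w | ((c - eps)%:E < random_metric F w p b)%E].
pose LB b := [set w | (random_metric F w b q < (- eps)%:E)%E].
(* Hits are searched from the end of the list: in [tA] from the lowest line up and from right to
   left, in [tB] in the opposite order. *)
pose tA := sort later sA.
pose tB := sort (fun x y => later y x) sB.
have mVA a : measurable (VA a).
  apply: (sub_m (future a)); apply: (@sigma_exists _ _ sB) => b.
  by apply: future_metric_gt; exact: later_refl.
have pastA a : <<s region_class F (past a) >> (LA a).
  by apply: sigma_metric_lt => c'; apply: past_metric_gt; exact: later_refl.
have futureB b : <<s region_class F (future b) >> (LB b).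
  by apply: sigma_metric_lt => c'; apply: future_metric_gt; exact: later_refl.
have mLA a : measurable (LA a) by exact: sub_m (pastA a).
have mLB b : measurable (LB b) by exact: sub_m (futureB b).
have bA : fine (P (first_hit VA LA tA)) <= alpha.
  apply: (@first_hit_bound _ _ _ P _ VA LA later (fun a => region_class F (past a))
    (fun a => region_class F (future a))) => //.
  - exact: later_refl.
  - exact: later_trans.
  - by apply: sort_sorted; exact: later_total.
  - by move=> a; exact: region_class_measurable.
  - by move=> a; exact: region_class_measurable.
  - by move=> a; exact: past_future_indep.
  - move=> a a' aa'; apply: (@sigma_exists _ _ sB) => b.
    exact: future_metric_gt.
  - by move=> a; rewrite mem_sort; exact: PA.
have bB : fine (P (first_hit VB LB tB)) <= beta.
  apply: (@first_hit_bound _ _ _ P _ VB LB (fun x y => later y x)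
    (fun b => region_class F (future b)) (fun b => region_class F (past b))) => //.
  - exact: later_refl.
  - by move=> x y z xy yz; exact: later_trans yz xy.
  - by apply: sort_sorted => x y; exact: later_total.
  - by move=> b; exact: region_class_measurable.
  - by move=> b; exact: region_class_measurable.
  - by move=> b; apply: indep_classesC; exact: past_future_indep.
  - by move=> b b' bb'; exact: past_metric_gt.
  - by move=> b; rewrite mem_sort; exact: PB.
have mE : measurable E.
  apply: measurableI.
    have := @sigma_metric_le measurable p q (c - 2 * eps).
    by rewrite sigma_algebra_id; [apply; exact: m_gt|exact: sigma_algebra_measurable].
  rewrite [X in measurable X](_ : _ = hit VA sA); first exact: measurable_hit.
  by apply/seteqP; split=> w /=; rewrite hitP.
split=> //.
have mhA : measurable (first_hit VA LA tA) by exact: measurable_first_hit.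
have mhB : measurable (first_hit VB LB tB).
  by apply: measurable_first_hit => // b; exact: m_gt.
apply: le_trans (lerD bA bB); rewrite -fineD ?fin_num_measure//.
rewrite fine_le ?fin_numD ?fin_num_measure//.
apply: le_trans (measureU2 _ mhA mhB).
apply: le_measure; rewrite ?inE//; first exact: measurableU.
(* Outside both exceptional events some [a'] has [d p a' >= - eps] and [d a' b > c], so
   [d p b > c - eps]. Hence [VB] is hit, and some [b'], possibly other than [b], has
   [d p b' > c - eps] and [d b' q >= - eps], which contradicts [pq]. *)
move=> w [pq [a aA VAa]]; apply: contrapT => /not_orP[nA nB].
have /first_hitPn/(_ nA)[a' [_ [b bsB ab]]] : hit VA tA w.
  by apply/hitP; exists a => //; rewrite mem_sort.
move=> /negP; rewrite -leNgt => pa.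
have pb : VB b w by rewrite /VB /= addrC; exact: metric_triangle_ge ab.
have /first_hitPn/(_ nB)[b' [_ pb' /negP]] : hit VB tB w.
  by apply/hitP; exists b => //; rewrite mem_sort.
rewrite -leNgt => bq; have := metric_triangle_le pb' bq.
rewrite (_ : c - eps - eps = c - 2 * eps); last by ring.
by rewrite ltNge pq.
Qed.

End bridge.

Lemma sup_prob_ge (d : measure_display) (T : measurableType d) (R : realType)
    (P : probability T R) (X : Type) (A : set X) (E : X -> set T) (a : X) :
  (forall a, measurable (E a)) -> A a -> fine (P (E a)) <= sup_prob P A E.
Proof.
move=> mE Aa; apply: ub_le_sup; last by exists a.
exists 1 => _ [b _ <-]; rewrite -lee_fin fineK ?fin_num_measure//.
exact: probability_le1.
Qed.

Lemma sup_prob_ge0 (d : measure_display) (T : measurableType d) (R : realType)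
    (P : probability T R) (X : Type) (A : set X) (E : X -> set T) :
  (forall a, measurable (E a)) -> 0 <= sup_prob P A E.
Proof.
(* For the empty family the real supremum takes its default value zero. *)
move=> mE; have [->|/set0P[a Aa]] := eqVneq A set0.
  by rewrite /sup_prob image_set0 sup0.
by apply: le_trans (sup_prob_ge P mE Aa); exact: fine_ge0.
Qed.
Theorem theorem1p15 (disp : measure_display) (T : measurableType disp)
    (R : realType) (P : probability T R) (F : int -> R -> {RV P >-> R})
    (A B : set (R * int)) (p q : R * int) (c eps : R) :
  independent_environment F ->
  finite_union_of_bounded_product_sets A ->
  finite_union_of_bounded_product_sets B ->
  0 < eps ->
  let d := random_metric F in
  fine (P [set w | (d w p q <= (c - 2 * eps)%:E)%E /\
                   (c%:E < set_to_set (d w) A B)%E])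
  <= sup_prob P A (fun a => [set w | (d w p a < (- eps)%:E)%E])
     + sup_prob P B (fun b => [set w | (d w b q < (- eps)%:E)%E]).
Proof.
move=> envF _ _ _; cbv zeta; set d := random_metric F.
have [Fc Fj _] := envF.
have [eA leA] := left_enum_exists A; have [eB reB] := right_enum_exists B.
set alpha := sup_prob P A _; set beta := sup_prob P B _.
have sub_m D : <<s region_class F D >> `<=` measurable.
  by apply: smallest_sub; [exact: sigma_algebra_measurable|exact: region_class_measurable].
have m_lt a b : measurable [set w | (d w a b < (- eps)%:E)%E].
  apply: (sub_m (past b)); apply: sigma_metric_lt => c'.
  by apply: past_metric_gt => //; exact: later_refl.
have alpha0 : 0 <= alpha by apply: sup_prob_ge0 => a; exact: m_lt.
have beta0 : 0 <= beta by apply: sup_prob_ge0 => b; exact: m_lt.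
(* The events for the points among the first [N] entries of the two enumerations; they increase to
   the event of the theorem. *)
pose En (N : nat) := [set w | (d w p q <= (c - 2 * eps)%:E)%E /\
  exists2 a, a \in pmap eA (iota 0 N) &
    exists2 b, b \in pmap eB (iota 0 N) & (c%:E < d w a b)%E].
have EnP N : measurable (En N) /\ fine (P (En N)) <= alpha + beta.
  apply: finite_bridge_bound => // [a|b]; rewrite mem_pmap => /mapP[i _ /esym ei].
    apply: (@sup_prob_ge _ _ _ P _ A (fun a => [set w | (d w p a < (- eps)%:E)%E])).
      by move=> ?; exact: m_lt.
    exact: leA.1 ei.
  apply: (@sup_prob_ge _ _ _ P _ B (fun b => [set w | (d w b q < (- eps)%:E)%E])).
    by move=> ?; exact: m_lt.
  exact: reB.1 ei.
have EE : [set w | (d w p q <= (c - 2 * eps)%:E)%E /\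
    (c%:E < set_to_set (d w) A B)%E] = \bigcup_N En N.
  apply/seteqP; split=> w.
    move=> [pq /(set_to_set_gtP c (Fc w) (Fj w) leA reB)[N H]].
    by exists N.
  move=> [N _ [pq H]]; split=> //.
  by apply/(set_to_set_gtP c (Fc w) (Fj w) leA reB); exists N.
have mE : measurable (\bigcup_N En N).
  by apply: bigcupT_measurable => N; have [] := EnP N.
rewrite EE; apply/ler_addgt0Pr => eta eta0.
have pmap_mono e N n (z : R * int) : (N <= n)%N ->
    z \in pmap e (iota 0 N) -> z \in pmap e (iota 0 n).
  move=> Nn; rewrite !mem_pmap => /mapP[i + ->].
  by rewrite mem_iota => iN; apply: map_f; rewrite mem_iota; lia.
have En_near w : (\bigcup_N En N) w -> \forall n \near \oo, En n w.
  move=> [N _ [pq [a aA [b bB ab]]]]; exists N => // n /= Nn; split=> //.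
  exists a; first exact: pmap_mono aA.
  by exists b => //; exact: pmap_mono bB.
have [N _ NP] := prob_liminf P mE (fun N => (EnP N).1) eta0 En_near.
apply: le_trans (NP N (leqnn N)) _.
by rewrite lerD2r; exact: (EnP N).2.
Qed.
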